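(* Consider the control system $\Sigma_1$: $\dot x=Lx+\Phi(x)+u_1f_1+\cdots+u_{n-1}f_{n-1}$ in $\mathbb{R}^n$, and assume either that the subspace $S_0=\mathrm{Span}\{f_1,\dots,f_{n-1}\}$ is not $L$-invariant, or that $\Phi(f_i)\in S_0$ for all $1\le i\le n-1$. Then $\Sigma_1$ is small-time locally controllable from the origin if and only if $S_1=\mathbb{R}^n$, where $S_1=S_0+\mathrm{Span}\{L\omega,\Phi(\omega)\mid\omega\in S_0\}$.
   Context: Setting. Let $n\ge 2$, $L$ a linear operator on $\mathbb{R}^n$ and $a,b,c\in\mathbb{R}^n$. Let $P_2,P_3$ be the cyclic permutation matrices $(P_2x)_i=x_{i+1}$, $(P_3x)_i=x_{i+2}$ (indices modulo $n$), and let $\odot$ be the Hadamard (componentwise) product. Define $\Phi(x)=a\odot P_2x\odot P_2x+b\odot P_3x\odot P_3x+c\odot P_2x\odot P_3x$. Control system. The control vector fields $f_1,\dots,f_{n-1}\in\mathbb{R}^n$ are constant and linearly independent. The control $u=(u_1,\dots,u_{n-1})$ takes values in a bounded set $U\subset\mathbb{R}^{n-1}$ whose affine hull is $\mathbb{R}^{n-1}$. Admissible controls are Lebesgue integrable functions $u(\cdot):[0,T]\to U$, $T>0$; an admissible trajectory is an absolutely continuous curve $x(\cdot):[0,T]\to\mathbb{R}^n$ satisfying the equation for almost all $t\in[0,T]$. Small-time local controllability. $\mathcal{R}(T,p)$ is the set of $q$ for which there is an admissible trajectory with $x(0)=p$, $x(T)=q$, and $\mathcal{R}(\le T,p)=\bigcup_{0\le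 t\le T}\mathcal{R}(t,p)$. The system is small-time locally controllable from $p$ if $p$ is in the interior of $\mathcal{R}(\le T,p)$ for all $T>0$.
   Formalization: It is additionally assumed that 0 lies in the interior of the convex hull of U; with only U bounded and of full affine hull the claim fails, e.g. n=2, Φ=0, Le1=e2, Le2=0, f1=e1, U={1,2}, where x1 never becomes negative. *)

(* Defs.v *)
From HB Require Import structures.
From mathcomp Require Import all_boot all_order all_algebra.
From mathcomp Require Import all_classical all_reals all_analysis.

Set Implicit Arguments.
Unset Strict Implicit.
Unset Printing Implicit Defensive.

Import Order.TTheory GRing.Theory Num.Theory.
Import numFieldNormedType.Exports.

Local Open Scope classical_set_scope.
Local Open Scope ring_scope.

Section Hulls.
Variables (R : realType) (V : lmodType R).

Definition linear_span (A : set V) : set V :=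
  [set v | exists (k : nat) (w : 'I_k -> V) (c : 'I_k -> R),
    (forall i, A (w i)) /\ v = \sum_(i < k) c i *: w i].

Definition affine_hull (A : set V) : set V :=
  [set v | exists (k : nat) (w : 'I_k -> V) (c : 'I_k -> R),
    [/\ forall i, A (w i), \sum_(i < k) c i = 1
      & v = \sum_(i < k) c i *: w i]].

(* A control set U with interior (convex_hull U) 0 is called proper. A full
   affine hull alone does not suffice for local controllability: x_1' = u,
   x_2' = x_1 with U = {1, 2} moves x_1 in one direction only. *)
Definition convex_hull (A : set V) : set V :=
  [set v | exists (k : nat) (w : 'I_k -> V) (c : 'I_k -> R),
    [/\ forall i, A (w i), forall i, 0 <= c i, \sum_(i < k) c i = 1
      & v = \sum_(i < k) c i *: w i]].

End Hulls.

(* MathComp-Analysis has absolute continuity of measures, not of functions.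
   The two disjuncts on i, j say that the open intervals are disjoint. *)
Definition absolutely_continuous (R : realType) (V : normedModType R)
    (a b : R) (x : R -> V) : Prop :=
  forall e : R, 0 < e -> exists2 d : R, 0 < d &
    forall (k : nat) (s t : 'I_k -> R),
      (forall i, [/\ a <= s i, s i <= t i & t i <= b]) ->
      (forall i j, i != j -> t i <= s j \/ t j <= s i) ->
      \sum_(i < k) (t i - s i) < d ->
      \sum_(i < k) `|x (t i) - x (s i)| < e.

(* The control-affine system x' = F(x) + u_1 f_1 + ... + u_m f_m with control
   values in U. Controls and trajectories on [0, T] are represented by
   functions on R whose values outside [0, T] are irrelevant; the two-sided
   derivative below is required only almost everywhere, so the endpoints do not
   matter either. *)
Section ControlSystem.
Variables (R : realType) (n m : nat).
Variables (F : 'cV[R]_n -> 'cV[R]_n) (f : m.-tuple 'cV[R]_n).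
Variable U : set 'cV[R]_m.

Definition admissible_control (T : R) (u : R -> 'cV[R]_m) : Prop :=
  (forall t, `[0, T]%classic t -> U (u t)) /\
  (forall i, (@lebesgue_measure R).-integrable `[0, T]%classic
               (fun t => (u t i 0)%:E)).

Definition trajectory (T : R) (u : R -> 'cV[R]_m) (x : R -> 'cV[R]_n) : Prop :=
  absolutely_continuous 0 T x /\
  {ae @lebesgue_measure R, forall t, `[0, T]%classic t ->
     is_derive t 1 x (F (x t) + \sum_(i < m) u t i 0 *: tnth f i)}.

Definition admissible_trajectory (T : R) (x : R -> 'cV[R]_n) : Prop :=
  exists2 u, admissible_control T u & trajectory T u x.

(* For T = 0 the two properties of a trajectory are void, but an admissible
   control must have a value in U at time 0; hence reach 0 p = [set p]
   as soon as U is nonempty. *)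
Definition reach (T : R) (p : 'cV[R]_n) : set 'cV[R]_n :=
  [set q | exists x, [/\ admissible_trajectory T x, x 0 = p & x T = q]].

Definition reach_le (T : R) (p : 'cV[R]_n) : set 'cV[R]_n :=
  \bigcup_(t in `[0, T]%classic) reach t p.

Definition small_time_locally_controllable (p : 'cV[R]_n) : Prop :=
  forall T : R, 0 < T -> interior (reach_le T p) p.

End ControlSystem.

Section QuadraticField.
Variables (R : realType) (n : nat).

(* ordS is the successor modulo n, so these are (P2 x)_i = x_(i+1) and
   (P3 x)_i = x_(i+2) with cyclic indices. *)
Definition P2 : 'M[R]_n := \matrix_(i, j) (j == ordS i)%:R.
Definition P3 : 'M[R]_n := \matrix_(i, j) (j == ordS (ordS i))%:R.

Definition hadamard (x y : 'cV[R]_n) : 'cV[R]_n := map2_mx *%R x y.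

Local Notation "x ⊙ y" := (hadamard x y) (at level 40, left associativity).

Definition Phi (a b c x : 'cV[R]_n) : 'cV[R]_n :=
  a ⊙ (P2 *m x) ⊙ (P2 *m x) + b ⊙ (P3 *m x) ⊙ (P3 *m x)
  + c ⊙ (P2 *m x) ⊙ (P3 *m x).

Definition S0 (f : n.-1.-tuple 'cV[R]_n) : {vspace 'cV[R]_n} := <<f>>%VS.

Definition S1 (L : 'End('cV[R]_n)) (a b c : 'cV[R]_n)
    (f : n.-1.-tuple 'cV[R]_n) : set 'cV[R]_n :=
  [set v + w | v in [set v | v \in S0 f] &
     w in linear_span ([set L om | om in [set v | v \in S0 f]] `|`
                       [set Phi a b c om | om in [set v | v \in S0 f]])].

End QuadraticField.

(* Main.v *)
Require Import Defs.
From HB Require Import structures.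
From mathcomp Require Import all_boot all_order all_algebra.
From mathcomp Require Import all_classical all_reals all_analysis.
From mathcomp Require Import measurable_realfun ring lra.

Set Implicit Arguments.
Unset Strict Implicit.
Unset Printing Implicit Defensive.

Import Order.TTheory GRing.Theory Num.Theory.
Import numFieldNormedType.Exports.

Local Open Scope classical_set_scope.
Local Open Scope ring_scope.

(** The controls move the state freely along the hyperplane [S0], so only one
coordinate matters: a linear form [lam] with kernel [S0], whose evolution
[lam x' = lam (L x) + lam (Phi x)] contains no control.

If [S1] is not the whole space then [S1 = S0], so [L] and [Phi] both map [S0]
into itself.  Along a trajectory from the origin [y = lam x] then satisfies
[|y'| <= C |y|] almost everywhere, and Gronwall's inequality for absolutely
continuous functions ([gronwall_ae]) keeps the trajectory in [S0].

Conversely suppose that [S1] is the whole space.  Either some [lam (L om)] with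
[om] in [S0] is nonzero, or [S0] is [L]-invariant and [lam o Phi] is a nonzero
quadratic form on [S0].  In the second case the hypothesis makes the form
vanish at every [f_i], hence it is indefinite ([quadratic_positive]).  Put
[g = lam o L], [k = 1] in the first case and [g = lam o Phi], [k = 2] in the
second; in both [g] takes both signs on [S0].

Rescale time and space by a small [eps], that is [x t = eps *: xi (t / eps)].
Then [xi' = eps L xi + eps^2 Phi xi + sum_i u_i f_i] on [[0, 1]], so to leading
order [xi] is the primitive of the control.  If that primitive is close to the
loop [t (1 - t) om] in [S0], then [lam (xi 1)] is
[eps^k g(om) int_0^1 (t (1 - t))^k dt] up to a relatively small error
([drift_order], [drift_gain]): loops with [g om > 0] push the state to one side
of [S0], loops with [g om < 0] to the other.

Since the controls lie in [U], which need be neither convex nor a neighbourhood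
of [0], a loop is followed by chattering: [[0, 1]] is cut into [N] cells, and on
each cell the control runs through finitely many points of [U], for durations
which are affine functions of the desired mean velocity.  The primitive [w p om]
so obtained ends at [p], stays close to the loop of shape [om] when [p = 0], and
is Lipschitz in [p] and [om] ([chattering]).  The remaining part of [xi], the
integral of the drift, is obtained together with the end point [p] from one
contraction, in which [p] is tuned so that the controlled coordinates of [xi 1]
are exactly prescribed ([guided_exists]); the result depends continuously on
[om] ([guided_dist]).  Joining a positive loop to a negative one by a path of
shapes [om], the intermediate value theorem provides a shape for which [lam]
of the end point is prescribed as well ([local_steering]). *)

(** * Growth of absolutely continuous functions *)

(** Used to propagate along an interval bounds that are only known locally,
where the size of the local step cannot be controlled uniformly. *)
Lemma real_induction (R : realType) (P : R -> Prop) (a b : R) :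
  a <= b -> P a ->
  (forall t, a <= t <= b -> exists2 r, 0 < r & forall s1 s2,
     a <= s1 -> s1 <= t -> t <= s2 -> s2 <= b -> t - s1 < r -> s2 - t < r ->
     P s1 -> P s2) ->
  P b.
Proof.
move=> ab Pa step.
pose S := [set t | a <= t <= b /\ P t].
have Sa : S a by split=> //; rewrite lexx.
have ubS : ubound S b by move=> t [/andP[]].
have hS : has_sup S by split; [exists a | exists b].
have aS : a <= sup S by apply: ub_le_sup => //; exists b.
have Sb : sup S <= b by apply: ge_sup => //; exists a.
have [|r r0 hr] := step (sup S); first by rewrite aS.
have [s1 [/andP[as1 s1b] Ps1] s1r] := sup_adherent r0 hS.
have s1S : s1 <= sup S by apply: ub_le_sup; [exists b|split=> //; rewrite as1].
pose s2 := Num.min b (sup S + r / 2).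
have Ss2 : sup S <= s2 by rewrite le_min Sb lerDl ltW ?divr_gt0.
have Ps2 : P s2.
  apply: (hr s1 s2) => //; first by rewrite ge_min lexx.
    by rewrite ltrBlDr -ltrBlDl.
  rewrite ltrBlDr addrC (@le_lt_trans _ _ (sup S + r / 2)) //.
    by rewrite ge_min lexx orbT.
  by rewrite ltrD2l ltr_pdivrMr// mulr_natr mulr2n ltrDl.
have s2S : s2 <= sup S.
  apply: ub_le_sup; first by exists b.
  by split=> //; rewrite (le_trans aS Ss2) ge_min lexx.
move: s2S; rewrite /s2 ge_min => /orP[bS|]; last first.
  by rewrite gerDl leNgt divr_gt0.
by move: Ps2; rewrite /s2 min_l// (le_trans bS)// lerDl ltW ?divr_gt0.
Qed.

(** Serves for Gronwall's inequality and for the stability of fixed points: the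
supremum of [h] is finite and inherits the self-improving estimate. *)
Lemma halving (R : realType) (T : Type) (h : T -> R) (d0 e : R) :
  (forall t, h t <= d0) ->
  (forall d, (forall t, h t <= d) -> forall t, h t <= d / 2 + e) ->
  forall t, h t <= 2 * e.
Proof.
move=> h0 hh t.
pose s := sup (range h).
have hs u : h u <= s.
  by apply: ub_le_sup; [exists d0 => _ [v _ <-] | exists u].
have : s <= s / 2 + e.
  apply: ge_sup; first by exists (h t), t.
  by move=> _ [u _ <-]; exact: hh.
by have := hs t; lra.
Qed.

(** Lists of pairs are extended one by one in the proof of
[absolutely_continuous_le]; the newest interval comes first. *)
Lemma absolutely_continuous_seq (R : realType) (y : R -> R) (a b e : R) :
  absolutely_continuous a b y -> 0 < e ->
  exists2 d : R, 0 < d & forall l : seq (R * R),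
    all (fun p => [&& a <= p.1, p.1 <= p.2 & p.2 <= b]) l ->
    pairwise (fun p q => q.2 <= p.1) l ->
    \sum_(p <- l) (p.2 - p.1) < d ->
    \sum_(p <- l) `|y p.2 - y p.1| < e.
Proof.
move=> yac e0; have [d d0 hd] := yac _ e0; exists d => // l al pl.
rewrite (big_nth (0, 0)) big_mkord => sl.
rewrite (big_nth (0, 0)) big_mkord.
apply: hd sl => [i|i j ij].
  by have /(all_nthP (0, 0))/(_ _ (ltn_ord i))/and3P := al.
move/(pairwiseP (0, 0)) : pl => pl.
have [lij|lji] := ltnP i j.
  by right; apply: pl; rewrite ?inE.
left; apply: pl; rewrite ?inE //.
by rewrite ltn_neqAle lji andbT eq_sym.
Qed.

Lemma is_derive_le_near (R : realType) (y : R -> R) (t d c : R) :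
  is_derive t 1 y d -> d < c ->
  exists2 r, 0 < r & forall s1 s2, s1 <= t -> t <= s2 -> t - s1 < r ->
    s2 - t < r -> y s2 - y s1 <= c * (s2 - s1).
Proof.
move=> [dy yd] dc.
have : h^-1 *: ((y (h *: 1 + t)) - y t) @[h --> 0^'] --> d.
  by rewrite -yd; exact: dy.
move=> /cvgrPdist_lt /(_ (c - d)); rewrite subr_gt0 => /(_ dc).
move=> [r /= r0 hr]; exists r => // s1 s2 s1t ts2 s1r s2r.
have key s : s != t -> `|s - t| < r -> (s - t)^-1 * (y s - y t) < c.
  move=> st str.
  have := hr (s - t); rewrite /ball_/= sub0r normrN => /(_ str).
  rewrite subr_eq0 st => /(_ isT); rewrite [(s - t) *: 1]mulr1 subrK.
  by rewrite [_ *: _]/(_ * _) distrC => /ltr_normlW; rewrite ltrD2r.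
have H2 : y s2 - y t <= c * (s2 - t).
  move: ts2; rewrite le_eqVlt => /predU1P[->|ts2]; first by rewrite !subrr
    mulr0.
  rewrite -ler_pdivrMr ?subr_gt0// mulrC ltW// key ?gt_eqF//.
  by rewrite ger0_norm// subr_ge0 ltW.
have H1 : y t - y s1 <= c * (t - s1).
  move: s1t; rewrite le_eqVlt => /predU1P[->|s1t]; first by rewrite !subrr
    mulr0.
  rewrite -ler_pdivrMr ?subr_gt0// mulrC ltW//.
  rewrite -[y t - _]opprB -[t - s1]opprB invrN mulrNN key ?lt_eqF//.
  by rewrite distrC ger0_norm// subr_ge0 ltW.
by lra.
Qed.

(** The mean value inequality holds even if the derivative is only known almost
everywhere. Walk from [a] to [b]: at a point with derivative at most [c] the
function grows at rate at most [c + e] for a while; an exceptional point lies in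
an open set [G] of small measure, and there one crosses a small interval inside
[G]. By absolute continuity the crossings contribute little in total. *)
Lemma absolutely_continuous_le (R : realType) (y : R -> R) (a b c : R) :
  a <= b -> 0 <= c -> absolutely_continuous a b y ->
  {ae @lebesgue_measure R, forall t, `[a, b]%classic t ->
     exists2 d, is_derive t 1 y d & d <= c} ->
  y b - y a <= c * (b - a).
Proof.
move=> ab c0 yac [A [mA A0 badA]].
apply/ler_addgt0Pl => e0 e00.
(* The increment is bounded with c + e in place of c, and once more by e from
   the exceptional null set; the total loss is e * (b - a + 1) = e0. *)
pose e := e0 / (b - a + 1).
have ba1 : 0 < b - a + 1 by rewrite ltr_wpDl// subr_ge0.
have e_gt0 : 0 < e by rewrite divr_gt0.
suff : y b - y a <= (c + e) * (b - a) + e.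
  move/le_trans; apply; rewrite [leLHS](_ : _ = e * (b - a + 1) + c * (b - a));
    last by ring.
  by rewrite /e divfK// gt_eqF.
have [d d0 hd] := absolutely_continuous_seq yac e_gt0.
have [G [oG AG Gd]] : exists G : set R, [/\ open G, A `<=` G &
    (lebesgue_measure G < d%:E)%E].
  have Aoo : (lebesgue_measure A < +oo)%E by rewrite A0.
  have [G [oG AG GAd]] := lebesgue_regularity_outer mA Aoo d0.
  exists G; split => //; rewrite -(setDUK AG).
  rewrite measureU//; last 2 first.
    by apply: measurableD => //; exact: open_measurable.
    exact: setDIK.
  by rewrite [X in (X + _)%E]A0 add0e.
have mG : measurable G by exact: open_measurable.
have mGI t : measurable (G `&` `[a, t]%classic) by exact: measurableI.
(* The intervals in l are those that had to be crossed inside the open set G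
   covering the null set; their total length is at most the measure of G. *)
pose P t := exists l : seq (R * R), [/\
  all (fun p => [&& a <= p.1, p.1 <= p.2 & p.2 <= t]) l,
  pairwise (fun p q => q.2 <= p.1) l,
  ((\sum_(p <- l) (p.2 - p.1))%:E <= lebesgue_measure (G `&` `[a, t]%classic))%E
  & y t - y a <= (c + e) * (t - a) + \sum_(p <- l) `|y p.2 - y p.1|].
suff [l [al pl ml yl]] : P b.
  apply: (le_trans yl); rewrite lerD2l ltW//; apply: hd => //.
  rewrite -lte_fin (le_lt_trans ml)// (le_lt_trans _ Gd)//.
  apply: le_measure; rewrite ?inE; [exact: mGI|exact: mG|exact: subIsetl].
apply: (@real_induction _ P a b ab).
  exists [::]; split=> //; first by rewrite big_nil measure_ge0.
  by rewrite big_nil !subrr mulr0 addr0.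
move=> t tab.
have [At|nAt] := pselect (A t).
- have [r /= r0 rG] : nbhs t G by exact: oG (AG _ At).
  exists r => // s1 s2 as1 s1t ts2 s2b s1r s2r [l [al pl ml yl]].
  have s12 := le_trans s1t ts2.
  exists ((s1, s2) :: l); split.
  + rewrite /= as1 s12 lexx/=; apply: sub_all al => p /and3P[-> ->]/=.
    by move=> /le_trans; apply.
  + by rewrite /= pl andbT; apply: sub_all al => p /and3P[].
  + rewrite big_cons/= EFinD.
    apply: (@le_trans _ _ (lebesgue_measure `]s1, s2]%classic
        + lebesgue_measure (G `&` `[a, s1]%classic))%E).
      rewrite leeD// lebesgue_measure_itv/= lte_fin.
      by case: ltP => // s21; rewrite lee_fin subr_le0.
    have <- : lebesgue_measure (`]s1, s2]%classic `|` (G `&` `[a, s1]%classic))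
      =
        (lebesgue_measure `]s1, s2]%classic
        + lebesgue_measure (G `&` `[a, s1]%classic))%E.
      apply: measureU => //; first exact: mGI.
      rewrite -subset0 => x /= []; rewrite !in_itv/= => /andP[s1x _].
      by move=> [_ /andP[_]]; rewrite leNgt s1x.
    apply: le_measure; rewrite ?inE; [|exact: mGI|].
      by apply: measurableU; [exact: measurable_itv|exact: mGI].
    move=> x /= [|[Gx]]; rewrite in_itv/= => /andP[].
      move=> s1x xs2; split; last by rewrite /= in_itv/= xs2 (le_trans as1)//
        ltW.
      by apply: rG; rewrite /ball_/= ltr_norml; apply/andP; split; lra.
    by move=> ax xs1; split=> //=; rewrite in_itv/= ax (le_trans xs1).
  + rewrite big_cons/=.
    have yn := ler_norm (y s2 - y s1).
    have : (c + e) * (s1 - a) <= (c + e) * (s2 - a).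
      by rewrite ler_wpM2l ?lerD2r// addr_ge0// ltW.
    by lra.
- have [d' yd' d'c] : exists2 d', is_derive t 1 y d' & d' <= c.
    by apply: contra_notP nAt => nd; apply: badA => /= H; apply/nd/H.
  have [|r r0 hr] := @is_derive_le_near _ _ _ _ (c + e) yd'.
    by rewrite (le_lt_trans d'c)// ltrDl.
  exists r => // s1 s2 as1 s1t ts2 s2b s1r s2r [l [al pl ml yl]].
  have s12 := le_trans s1t ts2.
  exists l; split => //.
  + by apply: sub_all al => p /and3P[-> ->]/= /le_trans; apply.
  + apply: (le_trans ml); apply: le_measure; rewrite ?inE; [exact: mGI|exact:
      mGI|].
    by apply: setIS; apply: subset_itvl; rewrite bnd_simp.
  + by have := hr _ _ s1t ts2 s1r s2r; lra.
Qed.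

Lemma absolutely_continuous_bounded (R : realType) (V : normedModType R)
    (y : R -> V) (a b : R) :
  a <= b -> absolutely_continuous a b y ->
  exists B, forall t, a <= t <= b -> `|y t| <= B.
Proof.
move=> ab yac; have [d d0 hd] := yac _ ltr01.
have cl s t : a <= s -> s <= t -> t <= b -> t - s < d -> `|y t - y s| < 1.
  move=> as1 st tb std.
  have := hd 1 (fun=> s) (fun=> t).
  by rewrite !big_ord1; apply => // i j; rewrite !ord1 eqxx.
apply: (@real_induction _ (fun x => exists B, forall t, a <= t <= x -> `|y t|
  <= B)
  a b ab).
  by exists `|y a| => t; rewrite -eq_le => /eqP<-.
move=> t tab; exists (d / 2); first by rewrite divr_gt0.
move=> s1 s2 as1 s1t ts2 s2b s1d s2d [B hB].
exists (B + 1) => u /andP[au us2].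
have [us1|s1u] := leP u s1.
  by rewrite (le_trans (hB u _)) ?au// lerDl.
rewrite -[y u](subrK (y s1)) addrC (le_trans (ler_normD _ _))// lerD//.
  by apply: hB; rewrite as1 lexx.
apply: ltW; apply: cl => //; [exact: ltW|exact: le_trans us2 s2b|lra].
Qed.

Lemma absolutely_continuousS (R : realType) (V : normedModType R)
    (y : R -> V) (a b a' b' : R) :
  absolutely_continuous a b y -> a <= a' -> b' <= b ->
  absolutely_continuous a' b' y.
Proof.
move=> yac aa bb e e0; have [d d0 hd] := yac _ e0; exists d => // k s t st.
apply: hd => i; have [h1 h2 h3] := st i; split => //.
  exact: le_trans h1.
exact: le_trans bb.
Qed.

(** On a step so short that [C * (s2 - s1) <= 1 / 2], any bound for [|y|]
implies half that bound, so [y] stays zero; real induction joins the steps. *)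
Lemma gronwall_ae (R : realType) (y : R -> R) (C T : R) :
  0 <= T -> 0 <= C -> absolutely_continuous 0 T y -> y 0 = 0 ->
  {ae @lebesgue_measure R, forall t, `[0, T]%classic t ->
     exists2 d, is_derive t 1 y d & `|d| <= C * `|y t|} ->
  y T = 0.
Proof.
move=> T0 C0 yac y0 yd.
have [B0 hB0] := absolutely_continuous_bounded T0 yac.
suff : forall t, 0 <= t <= T -> y t = 0 by apply; rewrite T0 lexx.
apply: (@real_induction _ (fun x => forall t, 0 <= t <= x -> y t = 0) 0 T T0).
  by move=> t; rewrite -eq_le => /eqP<-.
move=> t tab; exists (4 * (C + 1))^-1; first by rewrite invr_gt0; lra.
move=> s1 s2 as1 s1t ts2 s2b s1d s2d ys1.
have C1 : 0 < C + 1 by lra.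
have s21 : C * (s2 - s1) <= 1 / 2.
  apply: (@le_trans _ _ ((C + 1) * ((4 * (C + 1))^-1 * 2))).
    by apply: ler_pM => //; lra.
  by rewrite [leLHS](_ : _ = 1 / 2)//; field; rewrite gt_eqF.
pose I := {u : R | 0 <= u <= s2}.
have h0 : forall u : I, `|y (sval u)| <= 2 * 0.
  apply: (@halving _ I (fun u => `|y (sval u)|) B0) => [[u /=]/andP[u0 us2]|].
    by apply: hB0; rewrite u0 (le_trans us2).
  move=> d hd [u /=]/andP[u0 us2]; rewrite addr0.
  have d0 : 0 <= d.
    have h : 0 <= s2 <= s2 by rewrite lexx andbT (le_trans u0).
    exact: le_trans (normr_ge0 _) (hd (exist _ s2 h)).
  have [us1|s1u] := leP u s1.
    by rewrite ys1 ?u0// normr0 divr_ge0.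
  have half : forall z : R -> R, absolutely_continuous 0 T z -> z s1 = 0 ->
      {ae @lebesgue_measure R, forall t, `[0, T]%classic t ->
     exists2 d, is_derive t 1 z d & `|d| <= C * `|y t|} -> z u <= d / 2.
    move=> z zac zs1 zd.
    have : z u - z s1 <= (C * d) * (u - s1).
      apply: absolutely_continuous_le; [exact: ltW|exact: mulr_ge0| |].
        by apply: absolutely_continuousS zac _ _ => //; exact: le_trans us2 _.
      move: zd; apply: filterS; first exact: (ae_filter_ringOfSetsType
        lebesgue_measure).
      move=> v hv /=; rewrite in_itv/= => /andP[s1v vu].
      have v0 : 0 <= v <= s2 by rewrite (le_trans as1 s1v) (le_trans vu).
      have [|dv zdv dvy] := hv; first by rewrite /= in_itv/=; lra.
      exists dv => //; rewrite (le_trans (ler_norm _))// (le_trans dvy)//.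
      by rewrite ler_wpM2l//; exact: hd (exist _ v v0).
    rewrite zs1 subr0 => /le_trans; apply.
    rewrite mulrAC mulrC ler_wpM2l// -[_^-1]mul1r.
    by rewrite (le_trans _ s21)// ler_wpM2l// lerD2r.
  rewrite ler_norml; apply/andP; split; last first.
    by apply: half => //; apply: ys1; rewrite as1 lexx.
  rewrite lerNl; apply: (half (fun v => - y v)).
  - move=> e /yac[r r0 hr]; exists r => // k s t' st' dis sm.
    rewrite (le_lt_trans _ (hr k s t' st' dis sm))// ler_sum// => i _.
    by rewrite -opprD normrN.
  - by rewrite ys1 ?oppr0// as1 lexx.
  - move: yd; apply: filterS; first exact: (ae_filter_ringOfSetsType
      lebesgue_measure).
    move=> v hv /hv[dv ydv dvy]; exists (- dv).
      exact: is_deriveN.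
    by rewrite normrN.
move=> u us2; apply/eqP; rewrite -normr_le0.
by have := h0 (exist _ u us2); rewrite mulr0.
Qed.

(** * Curves in spaces of column vectors *)

Lemma cV_norm_leP (R : realType) n (v : 'cV[R]_n) (e : R) :
  0 <= e -> `|v| <= e <-> forall i, `|v i 0| <= e.
Proof.
move=> e0; rewrite {1}/Num.Def.normr/= mx_normrE; split.
  move=> h i; apply: le_trans h.
  exact: (le_bigmax _ (fun p : 'I_n * 'I_1 => `|v p.1 p.2|) (i, 0)).
by move=> h; apply: bigmax_le => // -[i j] _ /=; rewrite ord1.
Qed.

Lemma linear_bound (R : realType) n (W : normedModType R)
    (g : {linear 'cV[R]_n -> W}) :
  exists2 C, 0 <= C & forall v, `|g v| <= C * `|v|.
Proof.
exists (\sum_(i < n) `|g (delta_mx i 0)|); first exact: sumr_ge0.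
move=> v; rewrite {1}(matrix_sum_delta v) linear_sum.
rewrite (le_trans (ler_norm_sum _ _ _))// mulr_suml ler_sum// => i _.
rewrite big_ord1 linearZ normrZ mulrC ler_wpM2l//.
by apply: (cV_norm_leP _ _).1.
Qed.

Lemma is_derive_linear (R : realType) n (W : normedModType R)
    (g : {linear 'cV[R]_n -> W}) (x : R -> 'cV[R]_n) (t : R) v :
  is_derive t 1 x v -> is_derive t 1 (g \o x) (g v).
Proof.
move=> [dx xv].
have cg : continuous g.
  apply: (@bounded_linear_continuous R 'cV[R]_n W g); apply/linear_boundedP.
  have [C C0 hC] := linear_bound g.
  exists C; split; first exact: ger0_real.
  by move=> r Cr u; rewrite (le_trans (hC u))// ler_wpM2r// ltW.
have cvx : h^-1 *: ((x (h *: 1 + t)) - x t) @[h --> 0^'] --> v.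
  by rewrite -xv; exact: dx.
have : h^-1 *: (((g \o x) (h *: 1 + t)) - (g \o x) t) @[h --> 0^'] --> g v.
  rewrite [X in X @ _](_ : _ = g \o (fun h => h^-1 *: ((x (h *: 1 + t)) - x
    t))).
    exact: (cvg_comp _ _ cvx (cg v)).
  by apply/funext => h /=; rewrite [in RHS]linearZ [in RHS]linearB.
move=> cvgv; split.
  apply/cvg_ex. exists (g v). exact: cvgv.
exact: cvg_lim cvgv.
Qed.

Lemma is_derive_cV (R : realType) n (x : R -> 'cV[R]_n) (t : R) v :
  is_derive t 1 x v <-> forall i, is_derive t 1 (fun s => x s i 0) (v i 0).
Proof.
split=> [[dx xv] i|h].
  have /derivable_mxP/(_ i 0) dxi := dx.
  by split => //; rewrite -xv derive_mx// mxE.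
have dx : derivable x t 1 by apply/derivable_mxP => i j; rewrite ord1; case: (h
  i).
split => //; rewrite derive_mx//; apply/matrixP => i j; rewrite mxE ord1.
by case: (h i).
Qed.

Lemma lipschitz_continuous (R : realType) (V : normedModType R) (h : R -> V) k :
  (forall s t, `|h s - h t| <= k * `|s - t|) -> continuous h.
Proof.
move=> hk t; apply/cvgrPdist_lt => e e0.
have k1 : 0 < `|k| + 1 by rewrite ltr_wpDl.
exists (e / (`|k| + 1)) => /=; first by rewrite divr_gt0.
move=> s /=; rewrite ltr_pdivlMr// mulrC; apply: le_lt_trans.
rewrite (le_trans (hk _ _))// ler_wpM2r// (le_trans (ler_norm _))// lerDl//.
Qed.

Lemma primitive_exists (R : realType) (h : R -> R) : continuous h ->
  exists2 H : R -> R, H 0 = 0 & forall t : R, 0 <= t <= 1 -> is_derive t 1 H (h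
    t).
Proof.
move=> ch.
pose G y := (\int[@lebesgue_measure R]_(s in [set` `[-1, y]]) h s)%R.
exists (fun y => G y - G 0); first by rewrite subrr.
move=> t /andP[t0 t1].
have ih : (@lebesgue_measure R).-integrable `[-1, 2] (EFin \o h).
  apply: continuous_compact_integrable; first exact: segment_compact.
  by apply: continuous_subspaceT.
have [dG Gt] : derivable G t 1 /\ G^`()%classic t = h t.
  by apply: (@continuous_FTC1_closed R h (-1) t 2 _ ih); [lra|lra|exact: ch].
have dGt : is_derive t 1 G (h t).
  by apply: (DeriveDef dG); rewrite -derive1E; exact: Gt.
by have := is_deriveB dGt (is_derive_cst (G 0) t 1); rewrite subr0.
Qed.

Lemma MVT_le_real (R : realType) (y dy : R -> R) (c : R) :
  (forall t : R, 0 <= t <= 1 -> is_derive t 1 y (dy t)) ->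
  (forall t, 0 <= t <= 1 -> `|dy t| <= c) ->
  forall s t, 0 <= s <= 1 -> 0 <= t <= 1 -> `|y t - y s| <= c * `|t - s|.
Proof.
move=> hy hc s t.
wlog st : s t / s <= t.
  move=> W s01 t01; have [st|/ltW ts] := leP s t; first exact: W.
  by rewrite distrC [`|t - s|]distrC; exact: W.
move=> /andP[s0 s1] /andP[t0 t1].
have [|||d] := @MVT_segment R y dy s t.
- exact: st.
- by move=> u; rewrite in_itv/= => /andP[su ut]; apply: hy; lra.
- apply: derivable_within_continuous => u; rewrite in_itv/= => /andP[su ut].
  by have [] : is_derive u 1 y (dy u) by apply: hy; lra.
rewrite in_itv/= => /andP[sd dt] ->; rewrite normrM ler_wpM2r//.
by apply: hc; lra.
Qed.

Lemma MVT_le (R : realType) n (H h : R -> 'cV[R]_n) (c : R) :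
  0 <= c ->
  (forall t : R, 0 <= t <= 1 -> is_derive t 1 H (h t)) ->
  (forall t, 0 <= t <= 1 -> `|h t| <= c) ->
  forall s t, 0 <= s <= 1 -> 0 <= t <= 1 -> `|H t - H s| <= c * `|t - s|.
Proof.
move=> c0 dH hc s t s01 t01.
apply/cV_norm_leP => [|i]; first by rewrite mulr_ge0.
rewrite !mxE; apply: (@MVT_le_real _ (fun u => H u i 0) (fun u => h u i 0)) =>
  // u u01.
  exact: ((is_derive_cV _ _ _).1 (dH u u01) i).
by apply: (cV_norm_leP _ _).1 => //; apply: hc.
Qed.

(** Banach's theorem for the distance [sup_t |x t - y t|]. Closedness of [X] is
only required under pointwise limits, so that Lipschitz conditions can be part
of [X] and no topology on functions is needed. *)
Lemma contraction_fixed_point (R : realType) (T : Type) n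
    (X : set (T -> 'cV[R]_n)) (F : (T -> 'cV[R]_n) -> T -> 'cV[R]_n)
    (x0 : T -> 'cV[R]_n) (d : R) :
  X x0 -> (forall x, X x -> X (F x)) ->
  (forall (x : nat -> T -> 'cV[R]_n) y, (forall k, X (x k)) ->
     (forall t, x k t @[k --> \oo] --> y t) -> X y) ->
  (forall x t, X x -> `|x t| <= d) ->
  (forall x y e, X x -> X y -> (forall t, `|x t - y t| <= e) ->
     forall t, `|F x t - F y t| <= e / 2) ->
  exists2 x, X x & forall t, F x t = x t.
Proof.
move=> Xx0 XF Xlim Xd Fe.
pose x k := iter k F x0.
have Xx k : X (x k) by elim: k => //= k; exact: XF.
have xd k : forall j t, `|x (k + j)%N t - x k t| <= 2 * d / 2 ^+ k.
  elim: k => [|k ih] j t.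
    rewrite divr1 mulr_natl mulr2n (le_trans (ler_normB _ _))// lerD//; exact:
      Xd.
  by rewrite exprS invfM mulrC -mulrA mulrC [_ * (2 * d)]mulrC; apply: Fe =>
    //; exact: ih.
have cx t : cvg (x k t @[k --> \oo]).
  apply/cauchy_cvgP/cauchy_exP => e e0.
  have : geometric (2 * d) (2^-1) k @[k --> \oo] --> (0 : R).
    by apply: cvg_geometric; rewrite ger0_norm ?invr_ge0// invf_lt1// ltr1n.
  move=> /cvgrPdist_lt/(_ _ e0)[N _ hN].
  exists (x N t); exists N => // k /= Nk.
  rewrite -ball_normE /= distrC -(subnKC Nk) (le_lt_trans (xd _ _ _))//.
  have := hN N (leqnn N); rewrite /= sub0r normrN => /ltr_normlW.
  by rewrite exprVn.
pose y t := lim (x k t @[k --> \oo]).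
have xy t : x k t @[k --> \oo] --> y t by exact: cx.
have Xy : X y by apply: Xlim Xx _.
have xdy k t : `|x k t - y t| <= 2 * d / 2 ^+ k.
  have : `|x k t - x j t| @[j --> \oo] --> `|x k t - y t|.
    by apply: cvg_norm; apply: cvgB => //; exact: cvg_cst.
  move=> cv; rewrite -(cvg_lim _ cv)//; apply: limr_le; first by apply/cvg_ex;
    eexists; exact: cv.
  by exists k => // j /= kj; rewrite distrC -(subnKC kj).
exists y => // t.
have : x k.+1 t @[k --> \oo] --> F y t.
  apply/cvgrPdist_lt => e e0.
  have : geometric (2 * d) (2^-1) k @[k --> \oo] --> (0 : R).
    by apply: cvg_geometric; rewrite ger0_norm ?invr_ge0// invf_lt1// ltr1n.
  move=> /cvgrPdist_lt/(_ _ e0)[N _ hN].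
  exists N => // k /= Nk.
  have := hN k Nk; rewrite /= sub0r normrN => /ltr_normlW; apply: le_lt_trans.
  rewrite distrC (le_trans (Fe _ _ _ (Xx k) Xy (xdy k) t))//.
  rewrite exprVn ler_pdivrMr// ler_peMr ?ler1n//.
  by apply: le_trans (xdy k t).
move=> /(cvg_unique _) => /(_ _ (y t)) -> //.
by have := xy t; rewrite -(cvg_shiftS (fun k => x k t)).
Qed.

(** * Primitives of piecewise constant controls *)

(** [w] is, on [[0, 1]], a primitive of a measurable control with values in [U].
The derivative is allowed to fail on a countable set, which, unlike an almost
everywhere condition, is trivially stable under rescaling of time. *)
Definition realizable (R : realType) m (U : set 'cV[R]_m) (w : R -> 'cV[R]_m) :=
  exists u : R -> 'cV[R]_m, [/\ forall t, U (u t),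
    forall i, measurable_fun setT (fun t => u t i 0) &
    exists2 A : set R, countable A &
      forall t : R, 0 <= t <= 1 -> ~ A t -> is_derive t 1 w (u t)].

Section PiecewiseConstant.
Context {R : realType} {m : nat}.
Variables (J : nat) (nu : nat -> 'cV[R]_m).

Definition breakpoint (d : nat -> R) (k : nat) : R := \sum_(j < k) d j.

(** The time spent in the [j]-th interval up to time [t]. *)
Definition pulse (d : nat -> R) (t : R) (j : nat) : R :=
  Num.min t (breakpoint d j.+1) - Num.min t (breakpoint d j).

(** The primitive of the control equal to [nu j] during the [j]-th interval.
Being built from minima it is visibly Lipschitz in [t] and in the durations, and
is defined for all [t]. *)
Definition pc_path (d : nat -> R) (t : R) : 'cV[R]_m :=
  \sum_(j < J) pulse d t j *: nu j.

Lemma breakpointS d k : breakpoint d k.+1 = breakpoint d k + d k.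
Proof. by rewrite /breakpoint big_ord_recr. Qed.

Lemma sum_pulse d t : \sum_(j < J) pulse d t j =
  Num.min t (breakpoint d J) - Num.min t (breakpoint d 0).
Proof.
by rewrite -(big_mkord xpredT (pulse d t)) telescope_sumr.
Qed.

Section Durations.
Variable d : nat -> R.
Hypothesis d_ge0 : forall j, (j < J)%N -> 0 <= d j.

Lemma breakpoint_le i j : (i <= j)%N -> (j <= J)%N ->
  breakpoint d i <= breakpoint d j.
Proof.
move=> ij; elim: j ij => [|j ih]; first by rewrite leqn0 => /eqP ->.
rewrite leq_eqVlt => /predU1P[->//|]; rewrite ltnS => ij jJ.
by rewrite (le_trans (ih ij (ltnW jJ)))// breakpointS lerDl d_ge0.
Qed.

Lemma breakpoint_ge0 j : (j <= J)%N -> 0 <= breakpoint d j.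
Proof.
by move=> jJ; have := breakpoint_le (leq0n j) jJ; rewrite {1}/breakpoint
  big_ord0.
Qed.

Lemma pulse_breakpoint k j : (k <= J)%N -> (j < J)%N ->
  pulse d (breakpoint d k) j = if (j < k)%N then d j else 0.
Proof.
move=> kJ jJ; rewrite /pulse; case: ltnP => jk.
  rewrite !min_r ?breakpoint_le// ?(ltnW jk)//.
  by rewrite breakpointS addrC addKr.
by rewrite !min_l ?breakpoint_le ?subrr// ?(ltnW jJ)// (leq_trans jk).
Qed.

Lemma pc_path_breakpoint k : (k <= J)%N ->
  pc_path d (breakpoint d k) = \sum_(j < k) d j *: nu j.
Proof.
move=> kJ; rewrite /pc_path (big_ord_widen J (fun j => d j *: nu j) kJ)
  [RHS]big_mkcond.
apply: eq_bigr => j _; rewrite pulse_breakpoint//.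
by case: ifP => // _; rewrite scale0r.
Qed.

Lemma pulse_homo s t j : (j < J)%N -> s <= t -> pulse d s j <= pulse d t j.
Proof.
move=> jJ st; have dj := d_ge0 jJ; rewrite /pulse breakpointS.
set D := breakpoint d j.
case: (leP s (D + d j)) => ?; case: (leP s D) => ?;
  by case: (leP t (D + d j)) => ?; case: (leP t D) => ?; lra.
Qed.

(** The constant is the bound of the velocities alone: at fixed [s <= t] the
increments of the pulses are nonnegative, and they telescope. A bound growing
with the number [J] of pieces would be useless for fine chattering. *)
Lemma pc_path_lipschitz M : 0 <= M -> (forall j, (j < J)%N -> `|nu j| <= M) ->
  forall s t, `|pc_path d s - pc_path d t| <= M * `|s - t|.
Proof.
move=> M0 hM s t; wlog st : s t / t <= s.
  move=> W; have [ts|/ltW st] := leP t s; first exact: W.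
  by rewrite distrC [`|s - t|]distrC; exact: W.
rewrite /pc_path -sumrB (le_trans (ler_norm_sum _ _ _))//.
apply: (@le_trans _ _ (\sum_(j < J) (pulse d s j - pulse d t j) * M)).
  apply: ler_sum => j _; rewrite -scalerBl normrZ ger0_norm.
    by rewrite ler_wpM2l ?hM// subr_ge0 pulse_homo.
  by rewrite subr_ge0 pulse_homo.
rewrite -mulr_suml mulrC ler_wpM2l// sumrB !sum_pulse ger0_norm ?subr_ge0//.
set a := breakpoint d J; set b := breakpoint d 0.
case: (leP s a) => ?; case: (leP s b) => ?;
  by case: (leP t a) => ?; case: (leP t b) => ?; lra.
Qed.

End Durations.

Lemma min_dist (t a b : R) : `|Num.min t a - Num.min t b| <= `|a - b|.
Proof.
rewrite ler_norml; have := ler_norm (a - b); have := ler_norm (b - a).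
rewrite distrC => ? ?.
by case: (leP t a) => ?; case: (leP t b) => ?; apply/andP; split; lra.
Qed.

Lemma pc_path_dist M d d' e : 0 <= M -> 0 <= e ->
  (forall j, (j < J)%N -> `|nu j| <= M) ->
  (forall j, (j < J)%N -> `|d j - d' j| <= e) ->
  forall t, `|pc_path d t - pc_path d' t| <= 2 * J%:R * J%:R * M * e.
Proof.
move=> M0 e0 hM hd t.
have hD k : (k <= J)%N -> `|breakpoint d k - breakpoint d' k| <= J%:R * e.
  move=> kJ; rewrite /breakpoint -sumrB (le_trans (ler_norm_sum _ _ _))//.
  apply: (@le_trans _ _ (\sum_(j < k) e)).
    by apply: ler_sum => j _; apply: hd; exact: leq_trans kJ.
  by rewrite sumr_const card_ord -[leLHS]mulr_natl ler_wpM2r// ler_nat.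
rewrite /pc_path -sumrB (le_trans (ler_norm_sum _ _ _))//.
apply: (@le_trans _ _ (\sum_(j < J) 2 * (J%:R * e) * M)).
  apply: ler_sum => j _; rewrite -scalerBl normrZ ler_pM ?hM//.
  have h1 := min_dist t (breakpoint d j.+1) (breakpoint d' j.+1).
  have h2 := min_dist t (breakpoint d j) (breakpoint d' j).
  have h3 := hD _ (ltn_ord j); have h4 := hD _ (ltnW (ltn_ord j)).
  rewrite /pulse [X in `|X|](_ : _ =
    (Num.min t (breakpoint d j.+1) - Num.min t (breakpoint d' j.+1)) -
    (Num.min t (breakpoint d j) - Num.min t (breakpoint d' j))); last by ring.
  by rewrite (le_trans (ler_normB _ _))//; lra.
by rewrite sumr_const card_ord -[leLHS]mulr_natl; lra.
Qed.

Lemma is_derive_min (t D : R) : t != D ->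
  is_derive t 1 (fun s => Num.min s D) (\1_`]-oo, D[ t).
Proof.
move=> tD; rewrite indicE; case: (ltP t D) => tD'.
  rewrite mem_set/= ?in_itv//=.
  apply: near_eq_is_derive (is_derive_id t 1).
  near=> s; rewrite min_l//; apply: ltW.
  by near: s; exact: lt_nbhsl.
rewrite memNset/= ?in_itv/= ?ltNge ?tD'//.
apply: near_eq_is_derive (is_derive_cst D t 1).
near=> s; rewrite min_r//=; apply: ltW.
by near: s; apply: lt_nbhsr; rewrite lt_neqAle eq_sym tD.
Unshelve. all: by end_near. Qed.

Lemma pc_path_realizable (U : set 'cV[R]_m) d :
  (0 < J)%N -> (forall j, (j < J)%N -> 0 <= d j) ->
  (forall j, (j < J)%N -> U (nu j)) -> breakpoint d J = 1 ->
  realizable U (pc_path d).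
Proof.
move=> J0 d_ge0 Unu DJ.
pose I D (t : R) : R := \1_`]-oo, D[ t.
have IE D t : I D t = if t < D then 1 else 0.
  rewrite /I indicE; case: ltP => tD; first by rewrite mem_set//= in_itv.
  by rewrite memNset//= in_itv/= ltNge tD.
have D0 : breakpoint d 0 = 0 by rewrite /breakpoint big_ord0.
(* The last summand only serves to keep the control in U outside [0, 1[. *)
exists (fun t => \sum_(j < J) (I (breakpoint d j.+1) t - I (breakpoint d j) t)
  *: nu j
  + (1 - I 1 t + I 0 t) *: nu 0%N); split.
- move=> t; have [t0|t0] := ltP t 0.
    rewrite big1 => [|j _].
      by rewrite !IE t0 (lt_trans t0 ltr01)/= subrr !add0r scale1r; exact: Unu.
    have h k : (k <= J)%N -> I (breakpoint d k) t = 1.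
      by move=> kJ; rewrite IE (lt_le_trans t0)// breakpoint_ge0.
    by rewrite !h ?subrr ?scale0r// ltnW.
  have [t1|t1] := ltP t 1; last first.
    rewrite big1 => [|j _].
      by rewrite !IE !ltNge t0 t1/= subr0 addr0 scale1r add0r; exact: Unu.
    have h k : (k <= J)%N -> I (breakpoint d k) t = 0.
      by move=> kJ; rewrite IE ltNge (le_trans _ t1)// -DJ breakpoint_le.
    by rewrite !h ?subrr ?scale0r// ltnW.
  have exk : exists k, t < breakpoint d k by exists J; rewrite DJ.
  case: (ex_minnP exk) => -[|k] tk hk; first by move: tk; rewrite D0 ltNge t0.
  have kJ : (k < J)%N by apply: hk; rewrite DJ.
  have kt : breakpoint d k <= t.
    by rewrite leNgt; apply/negP => /hk; rewrite ltnn.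
  rewrite (bigD1 (Ordinal kJ))//= big1 => [|j jk].
    rewrite !IE tk ltNge kt t1 ltNge t0/= !subrr subr0 !addr0 scale1r scale0r
      addr0.
    exact: Unu.
  have [jk'|kj|jk'] := ltngtP j k.
  + rewrite !IE !ltNge (le_trans _ kt) ?(le_trans _ kt) ?subrr ?scale0r//.
      by rewrite breakpoint_le// ltnW.
    by rewrite breakpoint_le// ltnW.
  + rewrite !IE !(lt_le_trans tk) ?subrr ?scale0r// breakpoint_le//.
      by rewrite ltnW.
    by rewrite ltnW.
  + by rewrite -(inj_eq val_inj)/= jk' eqxx in jk.
- move=> i.
  have mI D : measurable_fun setT (I D) by apply: measurable_indic; exact:
    measurable_itv.
  rewrite [X in measurable_fun _ X](_ : _ = fun t =>
    \sum_(j < J) (I (breakpoint d j.+1) t - I (breakpoint d j) t) * nu j i 0 +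
    (1 - I 1 t + I 0 t) * nu 0%N i 0); last first.
    apply/funext => t; rewrite !mxE summxE; congr (_ + _).
    by apply: eq_bigr => j _; rewrite mxE.
  apply: measurable_funD.
    apply: measurable_sum => j; apply: measurable_funM => //.
    exact: measurable_funB.
  apply: measurable_funM => //; apply: measurable_funD => //.
  exact: measurable_funB.
exists (range (breakpoint d)); first exact: sub_countable (card_image_le _ _)
  (countableP _).
move=> t /andP[t0 t1] nt.
have tD k : t != breakpoint d k.
  by apply/eqP => tk; apply: nt; exists k.
have -> : 1 - I 1 t + I 0 t = 0.
  rewrite !IE [t < 0]ltNge t0/= lt_neqAle t1 andbT.
  by have := tD J; rewrite DJ => ->; rewrite subrr addr0.
rewrite scale0r addr0; apply/is_derive_cV => i.
have : is_derive t 1 (\sum_(j < J) (fun s => nu j i 0 * pulse d s j))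
    (\sum_(j < J) nu j i 0 * (I (breakpoint d j.+1) t - I (breakpoint d j) t)).
  apply: is_derive_sum => j.
  apply: (is_deriveZ (nu j i 0)).
  by apply: is_deriveB; exact: is_derive_min.
move=> h; rewrite summxE.
rewrite [X in is_derive _ _ X _](_ : _ = \sum_(j < J) (fun s => nu j i 0 *
  pulse d s j)).
  by apply: (is_derive_eq h); apply: eq_bigr => j _; rewrite mxE mulrC.
apply/funext => s; rewrite fct_sumE /pc_path summxE.
by apply: eq_bigr => j _; rewrite mxE mulrC.
Qed.

End PiecewiseConstant.

(** * Chattering *)

Lemma sum_divmod (V : nmodType) (G : nat -> nat -> V) (K k : nat) :
  (0 < K)%N ->
  \sum_(j < k * K) G (j %/ K)%N (j %% K)%N = \sum_(a < k) \sum_(b < K) G a b.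
Proof.
move=> K0; elim: k => [|k ih]; first by rewrite mul0n !big_ord0.
rewrite big_ord_recr/= -ih mulSnr big_split_ord/=; congr (_ + _).
by apply: eq_bigr => b _; rewrite divnMDl// modnMDl divn_small// modn_small//
  addn0.
Qed.

(** It is enough to decompose the points [+-s e_j], which lie in the convex hull
of [U]: every small vector is an average of these points with coefficients that
are affine in the vector, hence Lipschitz. *)
Lemma proper_affine_weights (R : realType) (m : nat) (U : set 'cV[R]_m) :
  (0 < m)%N -> interior (convex_hull U) 0 ->
  exists (K : nat) (nu : nat -> 'cV[R]_m) (c : nat -> 'cV[R]_m -> R) (rho kappa
    : R),
  [/\ 0 < rho, 0 <= kappa, forall i, (i < K)%N -> U (nu i),
    forall i, (i < K)%N -> forall v, `|v| <= rho -> 0 <= c i v &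
    [/\ forall v, \sum_(i < K) c i v = 1,
      forall v, \sum_(i < K) c i v *: nu i = v &
      forall i v v', (i < K)%N -> `|c i v - c i v'| <= kappa * `|v - v'|]].
Proof.
move=> m0 /nbhs_ballP[r /= r0 rU].
pose s := r / 2; have s0 : 0 < s by rewrite divr_gt0.
pose X := ('I_m * bool)%type.
pose sg (x : X) : R := if x.2 then 1 else -1.
have sg1 x : `|sg x| = 1 by rewrite /sg; case: x.2; rewrite ?normrN normr1.
pose e (x : X) : 'cV[R]_m := delta_mx x.1 0.
have hX (x : X) : convex_hull U ((sg x * s) *: e x).
  apply: rU; rewrite -ball_normE /= sub0r normrN normrZ normrM.
  rewrite sg1 mul1r (gtr0_norm s0) (@le_lt_trans _ _ (s * 1))//.
    rewrite ler_wpM2l ?(ltW s0)//; apply/cV_norm_leP => // i.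
    by rewrite mxE; case: (_ && _); rewrite ?normr1 ?normr0.
  by rewrite mulr1 /s ltr_pdivrMr// mulr_natr mulr2n ltrDl.
pose k x := sval (cid (hX x)).
pose w x : 'I_(k x) -> 'cV[R]_m := sval (cid (svalP (cid (hX x)))).
pose q x : 'I_(k x) -> R := sval (cid (svalP (cid (svalP (cid (hX x)))))).
have hq x : [/\ forall i, U (w x i), forall i, 0 <= q x i,
    \sum_(i < k x) q x i = 1 & (sg x * s) *: e x = \sum_(i < k x) q x i *: w x
      i].
  exact: svalP (cid (svalP (cid (svalP (cid (hX x)))))).
pose I := {x : X & 'I_(k x)}.
(* The points +-s e_j all get weight 1 / (2 m) when v = 0, and moving v along
   e_j shifts weight from one of the two to the other. *)
pose al (x : X) (v : 'cV[R]_m) : R := (2 * m%:R)^-1 + sg x * v x.1 0 / (2 * s).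
pose nuI (y : I) := w (tag y) (tagged y).
pose cI (y : I) v := al (tag y) v * q (tag y) (tagged y).
have mR0 : (0 : R) < m%:R by rewrite ltr0n.
have sumI (V : zmodType) (F : forall x, 'I_(k x) -> V) :
    \sum_(y : I) F (tag y) (tagged y) = \sum_(x : X) \sum_(i < k x) F x i.
  by rewrite sig_big_dep.
have sumX (V : zmodType) (F : 'I_m -> bool -> V) :
    \sum_(x : X) F x.1 x.2 = \sum_j (F j true + F j false).
  by rewrite -(pair_bigA _ F)/=; apply: eq_bigr => j _; rewrite big_bool.
have sumc v : \sum_(y : I) cI y v = 1.
  rewrite (sumI _ (fun x i => al x v * q x i)).
  rewrite (eq_bigr (fun x => al x v)) => [|x _]; last first.
    by rewrite -mulr_sumr; have [_ _ -> _] := hq x; rewrite mulr1.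
  rewrite (sumX _ (fun j b => al (j, b) v)).
  rewrite (eq_bigr (fun=> m%:R^-1)) => [|j _].
    by rewrite sumr_const card_ord -[LHS]mulr_natl mulfV// gt_eqF.
  rewrite /al/sg/=; field; rewrite !gt_eqF//.
have sumv v : \sum_(y : I) cI y v *: nuI y = v.
  rewrite (eq_bigr (fun y : I => al (tag y) v *: (q (tag y) (tagged y) *: w
    (tag y) (tagged y))))
    => [|y _]; last by rewrite scalerA.
  rewrite (sumI _ (fun x i => al x v *: (q x i *: w x i))).
  rewrite (eq_bigr (fun x => (al x v * (sg x * s)) *: e x)) => [|x _]; last
    first.
    by rewrite -scaler_sumr; have [_ _ _ <-] := hq x; rewrite scalerA.
  rewrite (sumX _ (fun j b => (al (j, b) v * (sg (j, b) * s)) *: e (j, b))).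
  rewrite [RHS]matrix_sum_delta; apply: eq_bigr => j _; rewrite big_ord1.
  rewrite -scalerDl; congr (_ *: _).
  by rewrite /al/sg/=; field; rewrite !gt_eqF.
pose get (T : Type) (F : I -> T) (x0 : T) (i : nat) : T :=
  if insub i is Some j then F (enum_val (j : 'I_#|{: I}|)) else x0.
have getE (T : Type) (F : I -> T) x0 (i : 'I_#|{: I}|) : get T F x0 i = F
  (enum_val i).
  by rewrite /get valK.
have sumget (V : zmodType) (F : I -> V) :
    \sum_(y : I) F y = \sum_(i < #|{: I}|) F (enum_val i).
  by rewrite (reindex (fun i : 'I_#|{: I}| => enum_val i))//; apply: onW_bij;
    exact: enum_val_bij.
exists #|{: I}|, (get _ nuI 0), (get _ cI (fun=> 0)), (s / m%:R), (2 * s)^-1;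
  split.
- by rewrite divr_gt0.
- by rewrite invr_ge0 mulr_ge0// ltW.
- move=> i iI; rewrite (getE _ _ _ (Ordinal iI)) /nuI.
  by case: (hq (tag (enum_val (Ordinal iI)))).
- move=> i iI v vs; rewrite (getE _ _ _ (Ordinal iI)) /cI.
  set y := enum_val _; have [_ q0 _ _] := hq (tag y).
  rewrite mulr_ge0// /al.
  have h : `|sg (tag y) * v (tag y).1 0| <= s / m%:R.
    rewrite normrM sg1 mul1r; apply: (cV_norm_leP _ _).1 => //.
    by rewrite divr_ge0// ltW.
  have -> : (2 * m%:R)^-1 + sg (tag y) * v (tag y).1 0 / (2 * s) =
     (s / m%:R + sg (tag y) * v (tag y).1 0) / (2 * s).
    by field; rewrite !gt_eqF.
  rewrite divr_ge0//; last by rewrite mulr_ge0// ltW.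
  by move: h; rewrite ler_norml -lerBlDl sub0r => /andP[].
- split.
  + by move=> v; rewrite -[RHS](sumc v) sumget; apply: eq_bigr => i _; rewrite
      getE.
  + by move=> v; rewrite -[RHS](sumv v) sumget; apply: eq_bigr => i _; rewrite
      !getE.
  + move=> i v v' iI; rewrite (getE _ _ _ (Ordinal iI)) /cI.
    set y := enum_val _; have [_ q0 q1 _] := hq (tag y).
    rewrite -mulrBl normrM (ger0_norm (q0 _)).
    have qle : q (tag y) (tagged y) <= 1.
      by rewrite -q1 (bigD1 (tagged y))//= lerDl sumr_ge0.
    rewrite (le_trans (ler_wpM2l _ qle))// mulr1.
    have -> : al (tag y) v - al (tag y) v' = sg (tag y) * ((2 * s)^-1 * ((v -
      v') (tag y).1 0)).
      by rewrite /al !mxE; ring.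
    rewrite normrM sg1 mul1r normrM.
    rewrite (ger0_norm (_ : 0 <= (2 * s)^-1)); last by rewrite invr_ge0
      mulr_ge0// ltW.
    rewrite ler_wpM2l ?invr_ge0 ?mulr_ge0 ?(ltW s0) ?(ltW r0)//.
    exact: ((cV_norm_leP (v - v') (normr_ge0 _)).1 (lexx _)).
Qed.

(** On each of [N] cells of length [1 / N] the control visits all the points [nu
b] for the times [c b v / N], where [v] is the mean velocity required on the
cell. Hence the path is exact at the ends of the cells and off by at most [O(1 /
N)] between them. The Lipschitz constant [kappa] grows with [N], but [N] is
fixed by [delta]. *)
Lemma chattering (R : realType) (m : nat) (U : set 'cV[R]_m) :
  (0 < m)%N -> bounded_set U -> interior (convex_hull U) 0 ->
  exists rho M : R, [/\ 0 < rho, 0 <= M & forall delta, 0 < delta ->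
    exists kappa (w : 'cV[R]_m -> 'cV[R]_m -> R -> 'cV[R]_m), [/\ 0 <= kappa,
      forall p om, `|p| <= rho -> `|om| <= rho ->
        [/\ w p om 0 = 0, w p om 1 = p, 
          forall s t, `|w p om s - w p om t| <= M * `|s - t| &
          realizable U (w p om)],
      forall p om p' om', `|p| <= rho -> `|om| <= rho -> `|p'| <= rho ->
         `|om'| <= rho -> forall t,
         `|w p om t - w p' om' t| <= kappa * (`|p - p'| + `|om - om'|) &
      forall om t, `|om| <= rho -> 0 <= t <= 1 ->
        `|w 0 om t - (t * (1 - t)) *: om| <= delta]].
Proof.
move=> m0 [M1 [M1r hM1]] /(proper_affine_weights m0).
move=> [K [nu [c [rho0 [ka [rho00 ka0 Unu c_ge0 [sumc sumv clip]]]]]]].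
have K0 : (0 < K)%N.
  rewrite lt0n; apply/eqP => KE; have := sumc 0; rewrite KE big_ord0 =>
    /esym/eqP.
  by rewrite oner_eq0.
pose M := `|M1| + 1; have M_ge0 : 0 <= M by rewrite addr_ge0.
have nuM i : (i < K)%N -> `|nu i| <= M.
  by move=> /Unu; apply: hM1; rewrite (le_lt_trans (ler_norm _))// ltrDl.
pose rho := rho0 / 2; have rho_gt0 : 0 < rho by rewrite divr_gt0.
exists rho, M; split => // delta delta0.
pose N := (Num.truncn ((M + rho) / delta)).+1.
have N0 : (0 : R) < N%:R by rewrite ltr0n.
have hN : (M + rho) / N%:R <= delta.
  rewrite ler_pdivrMr// mulrC -ler_pdivrMr//; apply/ltW/truncnS_gt.
(* Midpoint values of p + (1 - 2 t) om, the velocity of t p + t (1 - t) om: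
   with them the chattering path agrees with that curve at the grid points. *)
pose v p om k : 'cV[R]_m := p + (1 - (2 * k%:R + 1) / N%:R) *: om.
pose d p om j := c (j %% K)%N (v p om (j %/ K)%N) / N%:R.
pose nuK j := nu (j %% K)%N.
pose J := (N * K)%N.
have J0 : (0 < J)%N by rewrite muln_gt0.
have vk01 k : (k < N)%N -> `|1 - (2 * k%:R + 1) / N%:R : R| <= 1.
  move=> kN; have : (k.+1%:R : R) <= N%:R by rewrite ler_nat.
  rewrite -natr1 => kN'; have k0 : (0 : R) <= k%:R by [].
  have -> : 1 - (2 * k%:R + 1) / N%:R = (N%:R - (2 * k%:R + 1)) / N%:R :> R.
    by field; rewrite gt_eqF.
  by rewrite ler_norml ler_pdivlMr// ler_pdivrMr//; lra.
have jK j : (j < J)%N -> (j %/ K < N)%N by rewrite ltn_divLR.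
have d_ge0 p om : `|p| <= rho -> `|om| <= rho -> forall j, (j < J)%N -> 0 <= d
  p om j.
  move=> pr omr j jJ; rewrite divr_ge0// c_ge0 ?ltn_pmod// /v.
  rewrite (le_trans (ler_normD _ _))// normrZ [leRHS](splitr rho0) lerD//.
  by rewrite -[leRHS]mul1r ler_pM// vk01// jK.
have bpk p om k : breakpoint (d p om) (k * K) = k%:R / N%:R.
  rewrite /breakpoint (sum_divmod (fun a b => c b (v p om a) / N%:R))//.
  rewrite (eq_bigr (fun=> N%:R^-1)) => [|a _].
    by rewrite sumr_const card_ord -[LHS]mulr_natl.
  by rewrite -mulr_suml sumc mul1r.
have wk p om k : `|p| <= rho -> `|om| <= rho -> (k <= N)%N ->
    pc_path J nuK (d p om) (k%:R / N%:R) =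
    (k%:R / N%:R) *: p + (k%:R / N%:R * (1 - k%:R / N%:R)) *: om.
  move=> pr omr kN; rewrite -[in LHS](bpk p om) pc_path_breakpoint; last 2
    first.
  - exact: d_ge0.
  - by rewrite leq_mul.
  rewrite (sum_divmod (fun a b => (c b (v p om a) / N%:R) *: nu b))// {kN}.
  rewrite (eq_bigr (fun a : 'I_k => N%:R^-1 *: v p om a)) => [|a _]; last first.
    rewrite -[in RHS](sumv (v p om a)) scaler_sumr; apply: eq_bigr => b _.
    by rewrite scalerA mulrC.
  elim: k => [|k ih]; first by rewrite big_ord0 !mul0r !scale0r addr0.
  rewrite big_ord_recr/= ih /v; apply/matrixP => i j; rewrite !mxE -natr1.
  by field; rewrite gt_eqF.
exists (2 * J%:R * J%:R * M * (ka / N%:R)), (fun p om => pc_path J nuK (d p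
  om)).
have nuKM j : (j < J)%N -> `|nuK j| <= M by rewrite nuM// ltn_pmod.
split.
- by rewrite !mulr_ge0// invr_ge0 ltW.
- move=> p om pr omr; split.
  + by have := wk p om 0 pr omr (leq0n _); rewrite !mul0r !scale0r addr0.
  + have := wk p om N pr omr (leqnn _); rewrite mulfV ?gt_eqF//.
    by rewrite subrr mulr0 scale0r addr0 scale1r.
  + by apply: pc_path_lipschitz => //; exact: d_ge0.
  + apply: pc_path_realizable => //; first exact: d_ge0.
      by move=> j _; apply: Unu; rewrite ltn_pmod.
    by rewrite /J bpk mulfV// gt_eqF.
- move=> p om p' om' pr omr pr' omr' t.
  rewrite -[leRHS]mulrA.
  apply: pc_path_dist => //.
    by rewrite !mulr_ge0// ?addr_ge0// invr_ge0 ltW.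
  move=> j jJ; rewrite /d -mulrBl normrM (ger0_norm (_ : 0 <= N%:R^-1))
    ?invr_ge0 ?(ltW N0)//.
  rewrite [leRHS]mulrAC ler_wpM2r ?invr_ge0 ?(ltW N0)//.
  rewrite (le_trans (clip _ _ _ (ltn_pmod _ K0)))// ler_wpM2l//.
  rewrite /v opprD addrACA -scalerBr (le_trans (ler_normD _ _))// lerD2l normrZ.
  by rewrite -[leRHS]mul1r ler_wpM2r// vk01// jK.
- move=> om t omr /andP[t0 t1].
  pose k := Num.truncn (t * N%:R).
  have tN0 : 0 <= t * N%:R by rewrite mulr_ge0// ltW.
  have /andP[kt tk] := truncn_itv tN0.
  have kN : (k <= N)%N.
    by rewrite -(ler_nat R) (le_trans kt)// ler_piMl// ltW.
  have p0 : `|0 : 'cV[R]_m| <= rho by rewrite normr0 ltW.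
  have hk := wk 0 om k p0 omr kN; rewrite scaler0 add0r in hk.
  set z := k%:R / N%:R in hk.
  have zt : z <= t by rewrite ler_pdivrMr.
  have tz : t <= z + N%:R^-1.
    by rewrite -[t](mulfK (lt0r_neq0 N0)) -[X in _ + X]mul1r -mulrDl ler_wpM2r
      ?invr_ge0 ?(ltW N0)// ltW// natr1.
  have z0 : 0 <= z by rewrite divr_ge0// ltW.
  rewrite [X in `|X|](_ : _ = (pc_path J nuK (d 0 om) t - pc_path J nuK (d 0
    om) z)
    + (z * (1 - z) - t * (1 - t)) *: om); last first.
    by rewrite hk scalerBl addrA subrK.
  rewrite (le_trans _ hN)// mulrDl (le_trans (ler_normD _ _))// lerD//.
    rewrite (le_trans (pc_path_lipschitz (d_ge0 _ _ p0 omr) M_ge0 nuKM _ _))//.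
    by rewrite ler_wpM2l// ger0_norm; lra.
  rewrite normrZ mulrC ler_pM// ler_norml.
  have zz : z * (1 - z) - t * (1 - t) = (t - z) * (t + z - 1) by ring.
  have Ni : 0 < N%:R^-1 :> R by rewrite invr_gt0.
  by rewrite zz; apply/andP; split; nra.
Qed.

(** * Solutions with prescribed controlled end point *)

Definition primitive (R : realType) n (h : R -> 'cV[R]_n) : R -> 'cV[R]_n :=
  xget (fun=> 0) [set H | H 0 = 0 /\
    forall t : R, 0 <= t <= 1 -> is_derive t 1 H (h t)].

Lemma primitiveP (R : realType) n (h : R -> 'cV[R]_n) : continuous h ->
  primitive h 0 = 0 /\
  forall t : R, 0 <= t <= 1 -> is_derive t 1 (primitive h) (h t).
Proof.
move=> ch.
suff [H hH] : exists H : R -> 'cV[R]_n, H 0 = 0 /\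
    forall t : R, 0 <= t <= 1 -> is_derive t 1 H (h t).
  have := @xgetPex _ (fun=> 0) [set H : R -> 'cV[R]_n | H 0 = 0 /\
    forall t : R, 0 <= t <= 1 -> is_derive t 1 H (h t)].
  by apply; exists H.
have /choice[H hH] : forall i, exists H : R -> R, H 0 = 0 /\
    forall t : R, 0 <= t <= 1 -> is_derive t 1 H (h t i 0).
  move=> i; have [|H H0 dH] := @primitive_exists R (fun t => h t i 0).
    move=> t; apply: (@continuous_comp _ _ _ h (fun v : 'cV[R]_n => v i 0)).
      exact: ch.
    exact: coord_continuous.
  by exists H.
exists (fun t => \col_i H i t); split.
  by apply/matrixP => i j; rewrite !mxE; case: (hH i).
move=> t t01; apply/is_derive_cV => i.
rewrite (_ : (fun s => _) = H i); first by case: (hH i) => _; exact.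
by apply/funext => s; rewrite mxE.
Qed.

Lemma cvg_norm_le (R : realType) (V : normedModType R) (u : nat -> V) l c :
  u k @[k --> \oo] --> l -> (forall k, `|u k| <= c) -> `|l| <= c.
Proof.
move=> ul uc; have nul : `|u k| @[k --> \oo] --> `|l| by exact: cvg_norm.
rewrite -(cvg_lim _ nul)//; apply: limr_le; first by apply/cvg_ex; exists `|l|.
exact: nearW.
Qed.

(** Curves on [[0, 1]] are extended by constants, so that all of them are
functions on the whole line. *)
Definition clamp (R : realType) (t : R) : R := Num.max 0 (Num.min t 1).

Lemma clamp01 (R : realType) (t : R) : 0 <= clamp t <= 1.
Proof.
rewrite /clamp; case: (leP t 1) => ?; first by case: (leP 0 t) => ?; lra.
by rewrite max_r ?ler01 ?lexx.
Qed.

Lemma clamp_id (R : realType) (t : R) : 0 <= t <= 1 -> clamp t = t.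
Proof. by move=> /andP[t0 t1]; rewrite /clamp min_l// max_r. Qed.

Lemma clamp_lipschitz (R : realType) (s t : R) :
  `|clamp s - clamp t| <= `|s - t|.
Proof.
rewrite ler_norml; have h1 := ler_norm (s - t); have h2 := ler_norm (t - s).
rewrite distrC in h2; rewrite /clamp.
case: (leP s 1) => ?; case: (leP t 1) => ?; case: (leP 0 s) => ?;
  case: (leP 0 t) => ?; case: (leP (0 : R) 1) => ?; apply/andP; split; lra.
Qed.

Section Guided.
Context {R : realType} {n m : nat}.
Variables (B : {linear 'cV[R]_m -> 'cV[R]_n}) (pi : {linear 'cV[R]_n ->
  'cV[R]_m}).
Variables (F : 'cV[R]_n -> 'cV[R]_n) (q : 'cV[R]_m).
Variables (CB Cpi M rho kappa eta : R).
Hypothesis CB0 : 0 <= CB.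
Hypothesis B_le : forall v, `|B v| <= CB * `|v|.
Hypothesis Cpi0 : 0 <= Cpi.
Hypothesis pi_le : forall v, `|pi v| <= Cpi * `|v|.
Hypothesis M0 : 0 <= M.
Hypothesis kappa0 : 0 <= kappa.
Hypothesis eta01 : 0 <= eta <= 1.
Let R1 := CB * M + 1.
Hypothesis F_le : forall x, `|x| <= R1 -> `|F x| <= eta.
Hypothesis F_lip : forall x z, `|x| <= R1 -> `|z| <= R1 ->
  `|F x - F z| <= eta * `|x - z|.
Hypothesis small : eta * (CB * kappa * Cpi + 1) <= 1 / 2.
Hypothesis q_le : `|q| + Cpi * eta <= rho.

(** [xi = B (w p) + z] solves the equation whose drift is [F] and whose control
is the derivative of [w p]; [z] is the integral of the drift. When [w p] ends at
[p] and [pi] is a left inverse of [B], the equation [pi (z 1) + p = q] says that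
the end point of [xi] has controlled coordinates [q]. *)
Definition guided (w : 'cV[R]_m -> R -> 'cV[R]_m) (xi : R -> 'cV[R]_n) p
    (z : R -> 'cV[R]_n) :=
  [/\ forall t, `|xi t| <= R1, `|p| <= `|q| + Cpi * eta,
    forall t, 0 <= t <= 1 -> xi t = B (w p t) + z t,
    pi (z 1) + p = q &
    [/\ z 0 = 0, forall t : R, 0 <= t <= 1 -> is_derive t 1 z (F (xi t)) &
    forall t, 0 <= t <= 1 -> `|z t| <= eta]].

Let R1_ge0 : 0 <= R1. Proof. by rewrite addr_ge0// mulr_ge0. Qed.

(** The parameter [p] is eliminated by [p = q - pi (z 1)], which makes the
solution a fixed point of a single map on curves. That map is a contraction:
[xi] enters it only through the integral of the drift, which is Lipschitz with
the small constant [eta], and [w] amplifies this by a factor independent of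
[eta]. *)
Lemma guided_exists (w : 'cV[R]_m -> R -> 'cV[R]_m) :
  (forall p, `|p| <= rho -> [/\ w p 0 = 0, w p 1 = p &
     forall s t, `|w p s - w p t| <= M * `|s - t|]) ->
  (forall p p', `|p| <= rho -> `|p'| <= rho -> forall t,
     `|w p t - w p' t| <= kappa * `|p - p'|) ->
  exists xi p z, guided w xi p z.
Proof.
move=> hw wlip; have /andP[eta0 eta1] := eta01.
pose X := [set xi : R -> 'cV[R]_n | (forall t, `|xi t| <= R1) /\
  forall s t, `|xi s - xi t| <= R1 * `|s - t|].
pose Z (xi : R -> 'cV[R]_n) := primitive (F \o xi).
pose P xi := q - pi (Z xi 1).
pose Psi xi t := B (w (P xi) (clamp t)) + Z xi (clamp t).
have XF xi : X xi -> continuous (F \o xi).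
  move=> [x1 x2]; apply: (@lipschitz_continuous _ _ _ (eta * R1)) => s t /=.
  by rewrite (le_trans (F_lip _ _))// -mulrA ler_wpM2l.
have ZP xi : X xi -> [/\ Z xi 0 = 0,
    forall t : R, 0 <= t <= 1 -> is_derive t 1 (Z xi) (F (xi t)) &
    forall s t, 0 <= s <= 1 -> 0 <= t <= 1 -> `|Z xi s - Z xi t| <= eta * `|s -
      t|].
  move=> Xxi; have [Z0 dZ] := primitiveP (XF _ Xxi); split => //.
  move=> s t s01 t01; apply: (MVT_le _ dZ) => // u u01 /=.
  by apply: F_le; case: Xxi.
have i01 : 0 <= (1 : R) <= 1 by rewrite ler01 lexx.
have i00 : 0 <= (0 : R) <= 1 by rewrite ler01 lexx.
have Zle xi t : X xi -> 0 <= t <= 1 -> `|Z xi t| <= eta.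
  move=> Xxi t01; have [Z0 _ Zl] := ZP _ Xxi.
  have := Zl t 0 t01 i00; rewrite Z0 !subr0 => /le_trans; apply.
  by move: t01 => /andP[t0 t1]; rewrite ger0_norm// ler_piMr.
have Ple xi : X xi -> `|P xi| <= `|q| + Cpi * eta.
  move=> Xxi; rewrite (le_trans (ler_normB _ _))// lerD2l (le_trans (pi_le
    _))//.
  by rewrite ler_wpM2l// Zle.
have Prho xi : X xi -> `|P xi| <= rho by move=> /Ple/le_trans; apply.
have XPsi xi : X xi -> X (Psi xi).
  move=> Xxi; have [w0 w1 wM] := hw _ (Prho _ Xxi); have [Z0 _ Zl] := ZP _ Xxi.
  have L s t : `|Psi xi s - Psi xi t| <= R1 * `|clamp s - clamp t|.
    rewrite /Psi opprD addrACA -linearB (le_trans (ler_normD _ _))// mulrDl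
      lerD//.
      by rewrite (le_trans (B_le _))// -mulrA ler_wpM2l.
    by rewrite (le_trans (Zl _ _ (clamp01 s) (clamp01 t)))// ler_wpM2r.
  split=> [t|s t].
    have := L t 0; rewrite /Psi (clamp_id i00) w0 Z0 linear0 addr0 !subr0.
    move=> /le_trans; apply; have /andP[c0 c1] := clamp01 t.
    by rewrite ger0_norm// ler_piMr.
  by rewrite (le_trans (L s t))// ler_wpM2l// clamp_lipschitz.
have Zd xi xi' d : X xi -> X xi' -> (forall t, `|xi t - xi' t| <= d) ->
    forall t, 0 <= t <= 1 -> `|Z xi t - Z xi' t| <= eta * d.
  move=> Xxi Xxi' hd t t01.
  have [Z0 dZ _] := ZP _ Xxi; have [Z0' dZ' _] := ZP _ Xxi'.
  have d0 : 0 <= d by exact: le_trans (hd 0).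
  have := @MVT_le R n (Z xi - Z xi') (fun t => F (xi t) - F (xi' t)) (eta * d).
  move=> /(_ _ _ _ 0 t); rewrite /= -![(_ - _ : _ -> _) _]/(_ - _) Z0 Z0'
    !subr0 => h.
  apply: le_trans (h _ _ _ _ _) _ => //.
  - exact: mulr_ge0.
  - by move=> u u01; apply: is_deriveB; [exact: dZ|exact: dZ'].
  - move=> u u01; rewrite (le_trans (F_lip _ _))//; [by case: Xxi|by case:
      Xxi'|].
    by rewrite ler_wpM2l.
  - by move: t01 => /andP[t0 t1]; rewrite ger0_norm// ler_piMr// mulr_ge0.
have [xi Xxi xiE] : exists2 xi, X xi & forall t, Psi xi t = xi t.
  apply: (@contraction_fixed_point R R n X Psi (fun=> 0) R1) => //.
  - by split=> [t|s t]; rewrite ?subr0 normr0// mulr_ge0.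
  - move=> x y Xx xy; split=> [t|s t].
      by apply: (cvg_norm_le (xy t)) => k; case: (Xx k).
    have xyst : x k s - x k t @[k --> \oo] --> y s - y t by apply: cvgB; exact:
      xy.
    by apply: (cvg_norm_le xyst) => k; case: (Xx k).
  - by move=> x t [].
  - move=> x y e Xx Xy xye t.
    have e0 : 0 <= e by exact: le_trans (xye 0).
    rewrite /Psi opprD addrACA -linearB (le_trans (ler_normD _ _))//.
    have h1 : `|B (w (P x) (clamp t) - w (P y) (clamp t))| <= CB * (kappa *
      (Cpi * (eta * e))).
      rewrite (le_trans (B_le _))// ler_wpM2l// (le_trans (wlip _ _ _ _ _))
        ?Prho//.
      rewrite ler_wpM2l// /P opprB addrC addrA subrK -linearB (le_trans (pi_le
        _))//.
      by rewrite ler_wpM2l// distrC Zd.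
    have h2 := Zd _ _ _ Xx Xy xye _ (clamp01 t).
    have h3 := ler_wpM2r e0 small.
    by lra.
exists xi, (P xi), (Z xi); have [Z0 dZ _] := ZP _ Xxi.
split; [by case: Xxi|exact: Ple| |by rewrite /P addrC subrK|split=> //].
  by move=> t t01; rewrite -xiE /Psi clamp_id.
by move=> t t01; exact: Zle.
Qed.

(** The estimate that makes the fixed point of [guided_exists] unique also
bounds its variation with the path; [e] measures the change of the shape of the
path, the change of [p] being part of the solution. *)
Lemma guided_dist (w w' : 'cV[R]_m -> R -> 'cV[R]_m) xi p z xi' p' z' e :
  0 <= e ->
  (forall t, 0 <= t <= 1 -> `|w p t - w' p' t| <= kappa * (`|p - p'| + e)) ->
  guided w xi p z -> guided w' xi' p' z' ->
  `|xi 1 - xi' 1| <= 2 * (CB * kappa * e).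
Proof.
move=> e0 ww' [xile _ xiE piz [z0 dz _]] [xile' _ xiE' piz' [z0' dz' _]].
have /andP[eta0 eta1] := eta01.
pose I := {t : R | 0 <= t <= 1}.
have i01 : 0 <= (1 : R) <= 1 by rewrite ler01 lexx.
suff H : forall t : I, `|xi (sval t) - xi' (sval t)| <= 2 * (CB * kappa * e).
  exact: (H (exist _ 1 i01)).
apply: (@halving _ I _ (R1 + R1)).
  by move=> t; rewrite (le_trans (ler_normB _ _))// lerD.
move=> d hd [t /= t01].
have d0 : 0 <= d by exact: le_trans (hd (exist _ 1 i01)).
have zz u : 0 <= u <= 1 -> `|z u - z' u| <= eta * d.
  move=> u01.
  have := @MVT_le R n (z - z') (fun t => F (xi t) - F (xi' t)) (eta * d).
  move=> /(_ _ _ _ 0 u); rewrite /= -![(_ - _ : _ -> _) _]/(_ - _) z0 z0'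
    !subr0 => h.
  apply: le_trans (h _ _ _ _ _) _ => //.
  - exact: mulr_ge0.
  - by move=> v v01; apply: is_deriveB; [exact: dz|exact: dz'].
  - move=> v v01; rewrite (le_trans (F_lip _ _))//.
    by rewrite ler_wpM2l//; exact: (hd (exist _ v v01)).
  - by rewrite lexx ler01.
  - by move: u01 => /andP[u0 u1]; rewrite ger0_norm// ler_piMr// mulr_ge0.
have pp : `|p - p'| <= Cpi * (eta * d).
  have -> : p - p' = pi (z' 1 - z 1).
    by rewrite linearB/= -[p](addKr (pi (z 1))) piz -[p'](addKr (pi (z' 1)))
      piz'
      opprD opprK addrACA subrr addr0 addrC.
  by rewrite (le_trans (pi_le _))// ler_wpM2l// distrC zz.
rewrite xiE// xiE'// opprD addrACA -linearB (le_trans (ler_normD _ _))//.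
have h1 : `|B (w p t - w' p' t)| <= CB * (kappa * (Cpi * (eta * d) + e)).
  rewrite (le_trans (B_le _))// ler_wpM2l// (le_trans (ww' _ t01))//.
  by rewrite ler_wpM2l// lerD2r.
have h2 := zz _ t01.
have h3 := ler_wpM2r d0 small.
by lra.
Qed.

End Guided.

(** * Rescaled trajectories and transversal gain *)

Lemma is_derive_rescale (R : realType) (V : normedModType R) (x : R -> V)
    (r t : R) v : 0 < r ->
  is_derive (t / r) 1 x v -> is_derive t 1 (fun s => r *: x (s / r)) v.
Proof.
move=> r0 [dx xv].
have cvx : h^-1 *: ((x (h *: 1 + t / r)) - x (t / r)) @[h --> 0^'] --> v.
  by rewrite -xv; exact: dx.
suff cv : h^-1 *: ((r *: x ((h *: 1 + t) / r)) - r *: x (t / r)) @[h --> 0^']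
  --> v.
  by split; [apply/cvg_ex; exists v; exact: cv|exact: cvg_lim cv].
apply/cvgrPdist_lt => e e0.
move/cvgrPdist_lt : cvx => /(_ e e0)[d /= d0 hd].
exists (d * r) => /=; first by rewrite mulr_gt0.
move=> h /=; rewrite sub0r normrN => hdr h0.
have := hd (h / r); rewrite /ball_/= sub0r normrN normrM normfV (gtr0_norm r0).
rewrite ltr_pdivrMr// => /(_ hdr); rewrite mulf_neq0 ?invr_eq0 ?(gt_eqF r0)//.
move=> /(_ isT); rewrite -scalerBr scalerA invfM invrK.
by rewrite ![_ *: 1]mulr1 -mulrDl.
Qed.

(** Curves solving the rescaled equation on [[0, 1]] are trajectories of
duration [r]. The drift of the rescaled equation is [F (r *: xi)], so that
nothing has to be assumed about the form of [F]. *)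
Lemma reach_rescaled (R : realType) n m (F : 'cV[R]_n -> 'cV[R]_n)
    (f : m.-tuple 'cV[R]_n) (U : set 'cV[R]_m)
    (B : {linear 'cV[R]_m -> 'cV[R]_n}) (r k : R) (w : R -> 'cV[R]_m)
    (xi z : R -> 'cV[R]_n) :
  (forall u, B u = \sum_(i < m) u i 0 *: tnth f i) ->
  bounded_set U -> 0 < r -> 0 <= k -> realizable U w ->
  (forall t, 0 <= t <= 1 -> xi t = B (w t) + z t) ->
  (forall s t, 0 <= s <= 1 -> 0 <= t <= 1 -> `|xi s - xi t| <= k * `|s - t|) ->
  (forall t : R, 0 <= t <= 1 -> is_derive t 1 z (F (r *: xi t))) ->
  xi 0 = 0 -> reach F f U r 0 (r *: xi 1).
Proof.
move=> hB [M [Mr UM]] r0 k0 [u [Uu mu [A cA du]]] xiE xik dz xi0.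
have sc t : 0 <= t <= r -> 0 <= t / r <= 1.
  by move=> /andP[t0 tr]; rewrite divr_ge0 ?(ltW r0)//= ler_pdivrMr// mul1r.
exists (fun t => r *: xi (t / r)); split; last 2 first.
- by rewrite mul0r xi0 scaler0.
- by rewrite divff// gt_eqF.
exists (fun t => u (t / r)).
  split=> [t _|i]; first exact: Uu.
  apply: measurable_bounded_integrable => //.
  - by rewrite /= lebesgue_measure_itv/=; case: ifP => _; rewrite ?ltry//
      -EFinB ltry.
  - apply: measurable_funTS.
    by apply: (measurableT_comp (mu i)); exact: mulrr_measurable.
  - exists (`|M| + 1); split; first by rewrite ger0_real// addr_ge0.
    move=> y hy t _ /=; have := UM y (le_lt_trans (ler_norm _) (lt_trans _ hy)).
    rewrite ltrDl ltr01 => /(_ isT _ (Uu (t / r))) uy.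
    by apply: (cV_norm_leP _ _).1 uy i; rewrite (le_trans _ (ltW hy))//
      addr_ge0.
split.
  move=> e e0; exists (e / (k + 1)); first by rewrite divr_gt0// ltr_wpDl.
  move=> l s t st _ sm.
  apply: (@le_lt_trans _ _ (\sum_(i < l) k * (t i - s i))).
    apply: ler_sum => i _; have [s0 ts tr] := st i.
    rewrite -scalerBr normrZ (gtr0_norm r0).
    have : `|xi (t i / r) - xi (s i / r)| <= k * `|t i / r - s i / r|.
      by apply: xik; apply: sc; lra.
    rewrite -mulrBl normrM (ger0_norm (_ : 0 <= t i - s i)) ?subr_ge0//.
    rewrite (ger0_norm (_ : 0 <= r^-1)) ?invr_ge0 ?(ltW r0)// => h.
    have := ler_wpM2l (ltW r0) h.
    by rewrite [X in _ <= X -> _](_ : _ = k * (t i - s i))//; field; rewrite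
      gt_eqF.
  rewrite -mulr_sumr.
  have ss0 : 0 <= \sum_(i < l) (t i - s i).
    by apply: sumr_ge0 => i _; rewrite subr_ge0; case: (st i).
  move: sm; rewrite ltr_pdivlMr ?ltr_wpDl//; apply: le_lt_trans.
  by rewrite mulrC ler_wpM2l// lerDl.
(* The derivative may fail at the images of the switching times, and at the
   two end points, beyond which xi need not be given by the formula. *)
have cB : countable ((fun a => r * a) @` A `|` ([set 0] `|` [set r])).
  have -> : ((fun a => r * a) @` A `|` ([set 0] `|` [set r])) =
    \bigcup_i (fun i : nat => if i is i'.+1 then if i' is _.+1 then [set r]
      else [set 0]
       else (fun a => r * a) @` A) i.
    apply/seteqP; split=> [x [Ax|[x0|xr]]|x [[|[|i]] _ /= h]].
    + by exists 0%N.
    + by exists 1%N.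
    + by exists 2%N.
    + by left.
    + by right; left.
    + by right; right.
  apply: bigcup_countable => //; case=> [|[|i]] _.
  - exact: sub_countable (card_image_le _ _) cA.
  - exact: countable1.
  - exact: countable1.
exists ((fun a => r * a) @` A `|` ([set 0] `|` [set r])); split.
- by apply: countable_measurable cB => x; exact: measurable_set1.
- exact: countable_lebesgue_measure0.
move=> t /= nt; apply: contrapT => nAt; apply: nt; rewrite in_itv/= => t0r.
have tr1 := sc t t0r.
have nA : ~ A (t / r).
  by move=> At; apply: nAt; left; exists (t / r) => //; rewrite mulrC divfK//
    gt_eqF.
have t0 : t != 0 by apply/eqP => t0; apply: nAt; right; left.
have tr : t != r by apply/eqP => t0'; apply: nAt; right; right.
rewrite -hB; apply: is_derive_rescale => //.
apply: (@near_eq_is_derive _ _ _ (fun s => B (w s) + z s)).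
  have h0 : 0 < t / r.
    by rewrite divr_gt0// lt_neqAle eq_sym t0; case/andP: t0r.
  have h1 : t / r < 1.
    by rewrite ltr_pdivrMr// mul1r lt_neqAle tr; case/andP: t0r.
  near=> s; rewrite xiE//; apply/andP; split; apply: ltW; near: s.
    exact: lt_nbhsr.
  exact: lt_nbhsl.
rewrite addrC; apply: is_deriveD; last exact: dz.
by apply: is_derive_linear; exact: du.
Unshelve. all: by end_near. Qed.

(** Integrates a lower bound for the transversal velocity along a loop. The
constant [30] comes from [k = 2] and is also valid for [k = 1], so that the two
orders of the drift need not be distinguished later. *)
Lemma drift_gain (R : realType) (y dy : R -> R) (g e : R) (k : nat) :
  0 <= g -> (0 < k <= 2)%N ->
  (forall t : R, 0 <= t <= 1 -> is_derive t 1 y (dy t)) ->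
  (forall t : R, 0 <= t <= 1 -> g * (t * (1 - t)) ^+ k - e <= dy t) ->
  g / 30 - e <= y 1 - y 0.
Proof.
move=> g0 k12 hy hdy.
(* The primitive of (t (1 - t)) ^ 2; its value at 1 is 1 / 30. *)
pose p : {poly R} := (3^-1 *: 'X^3 - 2^-1 *: 'X^4 + 5^-1 *: 'X^5).
have dyp (t : R) : 0 <= t <= 1 -> is_derive t 1 (y - g \*: horner p)
    (dy t - g * p^`().[t]).
  by move=> t01; apply: is_deriveB; exact: hy.
have dp t : p^`().[t] = t ^+ 2 * (1 - t) ^+ 2.
  rewrite /p !poly.derivE !hornerE/=.
  by field.
have [|||c] := @MVT_segment R (y - g \*: horner p) (fun t => dy t - g *
  p^`().[t]) 0 1.
- exact: ler01.
- by move=> t; rewrite in_itv/= => /andP[t0 t1]; apply: dyp; lra.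
- apply: derivable_within_continuous => t; rewrite in_itv/= => t01.
  by have [] := dyp t t01.
rewrite in_itv/= => c01; rewrite subr0 mulr1 dp.
rewrite -![(_ - _ : _ -> _) _]/(_ - _) /=.
have -> : p.[1] = 1 / 30 by rewrite /p !hornerE/=; field.
have -> : p.[0] = 0 by rewrite /p !hornerE/=; ring.
have := hdy c c01.
(* As 0 <= t (1 - t) <= 1, the case k = 1 is covered by the bound for k = 2. *)
have cc : g * (c * (1 - c)) ^+ 2 <= g * (c * (1 - c)) ^+ k.
  rewrite ler_wpM2l//; move: c01 => /andP[c0 c1].
  case: k k12 {hdy} => [//|[|[|//]]] _; last by [].
  by rewrite expr1 expr2 ler_piMr// ?mulr_ge0 ?subr_ge0//; nra.
move=> h1 h2.
have {}h2 : y 1 - g * (1 / 30) - (y 0 - g * 0) = dy c - g * (c ^+ 2 * (1 - c)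
  ^+ 2) by exact: h2.
move: cc h1 h2; rewrite exprMn.
move: (g * (c * (1 - c)) ^+ k) (g * (c ^+ 2 * (1 - c) ^+ 2)) => u v.
by lra.
Qed.

(** * Local steering *)

Lemma small_enough (R : realType) (T : R) (s : seq R) : 0 < T ->
  exists2 eps, 0 < eps <= T & forall a, a \in s -> eps * a <= 1.
Proof.
move=> T0; elim: s => [|a s [e /andP[e0 eT] he]].
  by exists T => //; rewrite T0 lexx.
have a0 : 0 < `|a| + 1 by rewrite ltr_wpDl.
exists (Num.min e (`|a| + 1)^-1).
  by rewrite lt_min e0 invr_gt0 a0/= ge_min eT.
have m0 : 0 <= Num.min e (`|a| + 1)^-1 by rewrite le_min (ltW e0) invr_ge0 ltW.
move=> b; rewrite inE => /predU1P[->|bs].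
  rewrite (@le_trans _ _ ((`|a| + 1)^-1 * (`|a| + 1)))//; last first.
    by rewrite mulVf// gt_eqF.
  rewrite (le_trans (ler_wpM2l m0 (_ : a <= `|a| + 1)))//.
    by rewrite (le_trans (ler_norm a))// lerDl.
  by rewrite ler_wpM2r ?(ltW a0)// ge_min lexx orbT.
have [b0|/ltW b0] := leP 0 b.
  by rewrite (le_trans _ (he b bs))// ler_wpM2r// ge_min lexx.
by rewrite (@le_trans _ _ 0)// mulr_ge0_le0.
Qed.

Section LocalSteering.
Context {R : realType} {n m : nat}.
Variables (L : {linear 'cV[R]_n -> 'cV[R]_n}) (Ph : 'cV[R]_n -> 'cV[R]_n).
Variable B : {linear 'cV[R]_m -> 'cV[R]_n}.
Variable lam : {linear 'cV[R]_n -> R^o}.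
Hypothesis PhZ : forall (k : R) x, Ph (k *: x) = k ^+ 2 *: Ph x.
Variable CPh : R.
Hypothesis CPh0 : 0 <= CPh.
Hypothesis Ph_lip : forall x z, `|Ph x - Ph z| <= CPh * (`|x| + `|z|) * `|x -
  z|.
Hypothesis lamB : forall u, lam (B u) = 0.

Let F x := L x + Ph x.

Let Ph_le x r : `|x| <= r -> `|Ph x| <= CPh * r * r.
Proof.
move=> xr; have r0 : 0 <= r by exact: le_trans xr.
have := Ph_lip x 0.
have -> : Ph 0 = 0 by have := PhZ 0 0; rewrite scale0r expr0n/= scale0r.
rewrite !subr0 normr0 addr0 => /le_trans; apply.
by rewrite ler_pM ?mulr_ge0// ler_wpM2l.
Qed.

Let FE (eps : R) x : F (eps *: x) = eps *: L x + eps ^+ 2 *: Ph x.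
Proof. by rewrite /F linearZ PhZ. Qed.

(** The transversal velocity has order [eps ^ k], with a leading coefficient
read off at the point [t (1 - t) B om] of the loop, where a map [g] homogeneous
of degree [k] takes the value [(t (1 - t)) ^ k g om]. The number [e] is the
distance of the solution from the loop; [C] may depend on the size of the
solution, but not on [eps] or on how precisely the loop is followed. *)
Definition drift_order (k : nat) (g : 'cV[R]_m -> R) :=
  forall r, 0 <= r -> exists2 C, 0 <= C & forall eps om e (b : R -> 'cV[R]_m)
      (xi z : R -> 'cV[R]_n),
    0 < eps -> eps <= 1 -> `|B om| <= r -> 0 <= e ->
    (forall t, 0 <= t <= 1 -> `|xi t| <= r) ->
    (forall t, 0 <= t <= 1 -> xi t = B (b t) + z t) ->
    z 0 = 0 -> (forall t : R, 0 <= t <= 1 -> is_derive t 1 z (F (eps *: xi t)))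
      ->
    (forall t, 0 <= t <= 1 -> `|xi t - (t * (1 - t)) *: B om| <= e) ->
    forall t, 0 <= t <= 1 ->
    `|lam (F (eps *: xi t)) - eps ^+ k * ((t * (1 - t)) ^+ k * g om)| <=
      C * eps ^+ k * (e + eps).

Lemma drift_order_linear : drift_order 1 (fun om => lam (L (B om))).
Proof.
move=> r r0.
have [Cl Cl0 hCl] := linear_bound lam.
have [CL CL0 hCL] := linear_bound L.
have c0 : 0 <= Cl * (CPh * r * r) by rewrite !mulr_ge0.
exists (Cl * CL + Cl * (CPh * r * r)); first by rewrite addr_ge0// mulr_ge0.
move=> eps om e b xi z eps0 eps1 Bom e0 xir xiE z0 dz xie t t01.
rewrite FE linearD !linearZ !expr1.
rewrite [X in `|X|](_ : _ = eps * lam (L (xi t - (t * (1 - t)) *: B om))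
    + eps ^+ 2 * lam (Ph (xi t))); last first.
  by rewrite !linearB/= !linearZ/= -![_ *: _]/(_ * _); ring.
rewrite (le_trans (ler_normD _ _))// (normrM eps) (normrM (eps ^+ 2)) normrX
  (gtr0_norm eps0).
have h1 : `|lam (L (xi t - (t * (1 - t)) *: B om))| <= Cl * CL * e.
  rewrite (le_trans (hCl _))// -mulrA ler_wpM2l// (le_trans (hCL _))//.
  by rewrite ler_wpM2l// xie.
have h2 : `|lam (Ph (xi t))| <= Cl * (CPh * r * r).
  by rewrite (le_trans (hCl _))// ler_wpM2l// Ph_le// xir.
apply: (@le_trans _ _ (eps * (Cl * CL * e) + eps ^+ 2 * (Cl * (CPh * r * r)))).
  by rewrite lerD// ler_wpM2l ?exprn_ge0 ?(ltW eps0)//.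
have h3 : 0 <= eps ^+ 2 * (Cl * CL) by rewrite mulr_ge0 ?exprn_ge0 ?mulr_ge0//
  ltW.
have h4 : 0 <= eps * e * (Cl * (CPh * r * r)) by rewrite mulr_ge0// mulr_ge0//
  ltW.
move: (Cl * (CPh * r * r)) (Cl * CL) h3 h4 => u v h3 h4.
by rewrite expr2 in h3 *; lra.
Qed.

(** When the hyperplane is [L]-invariant the linear term contributes [eps * al *
lam xi] only. As [lam xi] vanishes at time [0] and is driven by [Ph] alone, it
is [O(eps ^ 2)], so this contribution has order [eps ^ 3]. *)
Lemma drift_order_quadratic (al : R) : (forall v, lam (L v) = al * lam v) ->
  drift_order 2 (fun om => lam (Ph (B om))).
Proof.
move=> lamL r r0.
have [Cl Cl0 hCl] := linear_bound lam.
pose c1 := `|al| * (Cl * r) + Cl * (CPh * r * r).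
have c10 : 0 <= c1 by rewrite addr_ge0 ?mulr_ge0.
pose c2 := `|al| * c1 + Cl * (CPh * r * r).
have c20 : 0 <= c2 by rewrite addr_ge0 ?mulr_ge0.
exists (`|al| * c2 + Cl * (CPh * (r + r))).
  by rewrite addr_ge0// !mulr_ge0// addr_ge0.
move=> eps om e b xi z eps0 eps1 Bom e0 xir xiE z0 dz xie.
have lamxi t : 0 <= t <= 1 -> lam (xi t) = lam (z t).
  by move=> t01; rewrite xiE// linearD lamB add0r.
have lamF t : lam (F (eps *: xi t)) =
    eps * (al * lam (xi t)) + eps ^+ 2 * lam (Ph (xi t)).
  by rewrite FE linearD !linearZ lamL.
have hPh t : 0 <= t <= 1 -> `|lam (Ph (xi t))| <= Cl * (CPh * r * r).
  by move=> t01; rewrite (le_trans (hCl _))// ler_wpM2l// Ph_le// xir.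
(* A bootstrap: a bound for lam xi gives, by integration, a bound with one more
   factor eps, up to the eps ^ 2 coming from Ph. *)
have step c : 0 <= c -> (forall t, 0 <= t <= 1 -> `|lam (xi t)| <= c) ->
    forall t, 0 <= t <= 1 ->
    `|lam (xi t)| <= eps * (`|al| * c) + eps ^+ 2 * (Cl * (CPh * r * r)).
  move=> c0 hc t t01; rewrite lamxi//.
  have i0 : 0 <= (0 : R) <= 1 by rewrite lexx ler01.
  have := @MVT_le_real R (lam \o z) (fun t => lam (F (eps *: xi t)))
    (eps * (`|al| * c) + eps ^+ 2 * (Cl * (CPh * r * r))) _ _ 0 t i0 t01.
  rewrite /= z0 linear0 !subr0 => h; apply: le_trans (h _ _) _.
  - by move=> s s01; apply: is_derive_linear; exact: dz.
  - move=> s s01; rewrite lamF (le_trans (ler_normD _ _))// (normrM eps)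
      (normrM al) (normrM (eps ^+ 2)) normrX (gtr0_norm eps0).
    rewrite lerD// ler_wpM2l// ?exprn_ge0 ?(ltW eps0)//.
      by rewrite ler_wpM2l// hc.
    exact: hPh.
  - move: t01 => /andP[t0 t1]; rewrite (ger0_norm t0) ler_piMr// addr_ge0//.
      by rewrite mulr_ge0 ?(ltW eps0)// mulr_ge0.
    by rewrite mulr_ge0 ?exprn_ge0 ?(ltW eps0)// !mulr_ge0.
have b1 t : 0 <= t <= 1 -> `|lam (xi t)| <= eps * c1.
  move=> t01; apply: le_trans (step (Cl * r) _ _ t t01) _.
  - by rewrite mulr_ge0.
  - by move=> s s01; rewrite (le_trans (hCl _))// ler_wpM2l// xir.
  - rewrite /c1 mulrDr lerD2l expr2 -mulrA ler_wpM2l ?(ltW eps0)//.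
    by rewrite ler_piMl// !mulr_ge0.
have b2 t : 0 <= t <= 1 -> `|lam (xi t)| <= eps ^+ 2 * c2.
  move=> t01; apply: le_trans (step (eps * c1) _ b1 t t01) _.
    by rewrite mulr_ge0// ltW.
  by rewrite le_eqVlt; apply/orP; left; apply/eqP; rewrite /c2; ring.
move=> t t01; rewrite lamF.
have -> : (t * (1 - t)) ^+ 2 * lam (Ph (B om)) = lam (Ph ((t * (1 - t)) *: B
  om)).
  by rewrite PhZ linearZ.
rewrite [X in `|X|](_ : _ = eps * (al * lam (xi t)) +
    eps ^+ 2 * lam (Ph (xi t) - Ph ((t * (1 - t)) *: B om))); last first.
  by rewrite linearB; ring.
rewrite (le_trans (ler_normD _ _))// (normrM eps) (normrM al) (normrM (eps ^+
  2)) normrX (gtr0_norm eps0).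
have h1 : eps * (`|al| * `|lam (xi t)|) <= eps ^+ 2 * (`|al| * c2 * eps).
  apply: (@le_trans _ _ (eps * (`|al| * (eps ^+ 2 * c2)))).
    by rewrite ler_wpM2l ?(ltW eps0)// ler_wpM2l// b2.
  by rewrite le_eqVlt; apply/orP; left; apply/eqP; ring.
have h2 : `|lam (Ph (xi t) - Ph ((t * (1 - t)) *: B om))| <= Cl * (CPh * (r +
  r)) * e.
  rewrite (le_trans (hCl _))// -mulrA ler_wpM2l// (le_trans (Ph_lip _ _))//.
  rewrite ler_pM ?mulr_ge0 ?addr_ge0 ?xie// ler_wpM2l// lerD ?xir//.
  rewrite normrZ ger0_norm; last by move: t01 => /andP[t0 t1]; rewrite
    mulr_ge0// subr_ge0.
  rewrite (le_trans _ Bom)// ler_piMl//.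
  by move: t01 => /andP[t0 t1]; nra.
have h3 := ler_wpM2l (exprn_ge0 2 (ltW eps0)) h2.
have h4 : 0 <= eps ^+ 2 * (`|al| * c2 * e).
  by rewrite mulr_ge0 ?exprn_ge0 ?(ltW eps0)// !mulr_ge0.
have h5 : 0 <= eps ^+ 2 * (Cl * (CPh * (r + r)) * eps).
  by rewrite mulr_ge0 ?exprn_ge0 ?(ltW eps0)// !mulr_ge0 ?addr_ge0// ltW.
move: (eps ^+ 2) (`|al| * c2) (Cl * (CPh * (r + r))) h1 h3 h4 h5 => u v x h1 h3
  h4 h5.
by lra.
Qed.

Lemma rescaled_field_bounds (r : R) : 0 <= r ->
  exists2 CF, 0 <= CF & forall eps, 0 < eps -> eps <= 1 ->
    (forall y, `|y| <= r -> `|F (eps *: y)| <= eps * CF) /\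
    (forall y z, `|y| <= r -> `|z| <= r ->
       `|F (eps *: y) - F (eps *: z)| <= eps * CF * `|y - z|).
Proof.
move=> r0; have [CL CL0 hCL] := linear_bound L.
pose c1 := CL * r + CPh * r * r; pose c2 := CL + CPh * (r + r).
have c10 : 0 <= c1 by rewrite addr_ge0 ?mulr_ge0.
have c20 : 0 <= c2 by rewrite addr_ge0// mulr_ge0// addr_ge0.
exists (c1 + c2) => [|eps eps0 eps1]; first exact: addr_ge0.
have e2e x : 0 <= x -> eps ^+ 2 * x <= eps * x.
  by move=> x0; rewrite expr2 -mulrA ler_wpM2l ?(ltW eps0)// ler_piMl.
split=> [y yr|y z yr zr].
  apply: (@le_trans _ _ (eps * c1)); last first.
    by rewrite ler_wpM2l ?(ltW eps0)// lerDl.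
  rewrite FE (le_trans (ler_normD _ _))// (normrZ eps) (normrZ (eps ^+ 2))
    normrX.
  rewrite (gtr0_norm eps0) mulrDr lerD//.
    by rewrite ler_wpM2l ?(ltW eps0)// (le_trans (hCL _))// ler_wpM2l.
  by rewrite (le_trans (e2e _ _))// ler_wpM2l ?(ltW eps0)// Ph_le.
apply: (@le_trans _ _ (eps * c2 * `|y - z|)); last first.
  by rewrite ler_wpM2r// ler_wpM2l ?(ltW eps0)// lerDr.
rewrite !FE opprD addrACA -!scalerBr -linearB.
rewrite (le_trans (ler_normD _ _))// (normrZ eps) (normrZ (eps ^+ 2)) normrX.
rewrite (gtr0_norm eps0) -mulrA mulrDl mulrDr lerD//.
  by rewrite ler_wpM2l ?(ltW eps0).
rewrite (le_trans (e2e _ _))// ler_wpM2l ?(ltW eps0)// (le_trans (Ph_lip _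
  _))//.
by rewrite ler_wpM2r// ler_wpM2l// lerD.
Qed.

End LocalSteering.

(** The controlled coordinates are met exactly by [guided_exists] for every
shape [om] of the loop. The transversal coordinate is continuous in the shape;
it is too large for a multiple of [omp] and too small for a multiple of [omn].
*)
Lemma local_steering (R : realType) (n m : nat)
    (L : {linear 'cV[R]_n -> 'cV[R]_n}) (Ph : 'cV[R]_n -> 'cV[R]_n) (CPh : R)
    (B : {linear 'cV[R]_m -> 'cV[R]_n}) (pi : {linear 'cV[R]_n -> 'cV[R]_m})
    (lam : {linear 'cV[R]_n -> R^o})
    (f : m.-tuple 'cV[R]_n) (U : set 'cV[R]_m) (k : nat)
    (g : 'cV[R]_m -> R) (omp omn : 'cV[R]_m) :
  (forall (k : R) x, Ph (k *: x) = k ^+ 2 *: Ph x) ->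
  0 <= CPh ->
  (forall x z, `|Ph x - Ph z| <= CPh * (`|x| + `|z|) * `|x - z|) ->
  (forall u, pi (B u) = u) -> (forall u, lam (B u) = 0) ->
  (forall v, lam v = 0 -> pi v = 0 -> v = 0) ->
  (forall u, B u = \sum_(i < m) u i 0 *: tnth f i) ->
  (0 < m)%N -> bounded_set U -> interior (convex_hull U) 0 ->
  (0 < k <= 2)%N -> drift_order L Ph B lam k g ->
  (forall c om, 0 <= c -> g (c *: om) = c ^+ k * g om) ->
  0 < g omp -> g omn < 0 ->
  small_time_locally_controllable (fun x => L x + Ph x) f U 0.
Proof.
move=> PhZ CPh0 Ph_lip piB lamB lam_pi_inj.
pose F x := L x + Ph x.
rewrite -/F.
move=> hB m0 Ubd Uint k12 hdrift gZ gp0 gn0 T T0.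
have [rho [M [rho0 M0 chat]]] := chattering m0 Ubd Uint.
have [CB CB0 hCB] := linear_bound B.
have [Cp Cp0 hCp] := linear_bound pi.
have [Cl Cl0 hCl] := linear_bound lam.
pose r1 := CB * M + 1; have r10 : 0 <= r1 by rewrite addr_ge0// mulr_ge0.
pose r2 := r1 + CB * rho.
have r20 : 0 <= r2 by rewrite addr_ge0// mulr_ge0// ltW.
(* The chattering paths exist only for shapes of size at most rho, and both
   loops occur in the sum defining om below: hence the bound rho / 2. *)
pose s := rho / 2 / (`|omp| + `|omn| + 1).
have den0 : 0 < `|omp| + `|omn| + 1 by rewrite ltr_wpDl ?addr_ge0.
have s0 : 0 < s by rewrite !divr_gt0.
have sle v : `|v| <= `|omp| + `|omn| + 1 -> `|s *: v| <= rho / 2.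
  move=> vle; rewrite normrZ (gtr0_norm s0) /s -[leLHS]mulrA.
  rewrite ler_piMr ?divr_ge0 ?(ltW rho0)//.
  by rewrite mulrC ler_pdivrMr// mul1r.
pose op := s *: omp; pose on := s *: omn.
have ople : `|op| <= rho / 2 by apply: sle; have := normr_ge0 omn; lra.
have onle : `|on| <= rho / 2 by apply: sle; have := normr_ge0 omp; lra.
have sk0 : 0 < s ^+ k by rewrite exprn_gt0.
have gop : 0 < g op by rewrite gZ ?(ltW s0)// mulr_gt0.
have gon : g on < 0 by rewrite gZ ?(ltW s0)// pmulr_rlt0.
clearbody op on.
pose gam := Num.min (g op) (- g on).
have gam0 : 0 < gam by rewrite lt_min gop oppr_gt0.
have gamp : gam <= g op by rewrite ge_min lexx.
have gamn : gam <= - g on by rewrite ge_min lexx orbT.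
have [C C0 hC] := hdrift r2 r20.
(* A loop of strength gam gains gam / 30.  The chattering error del and the
   error due to eps may each cost gam / 180, which leaves gam / 45. *)
pose del := gam / (180 * (C * CB + 1)).
have CCB : 0 < C * CB + 1 by rewrite ltr_wpDl// mulr_ge0.
have del0 : 0 < del by rewrite divr_gt0// mulr_gt0.
have hdel : C * (CB * del) <= gam / 180.
  have -> : C * (CB * del) = gam / 180 * (C * CB / (C * CB + 1)).
    by rewrite /del; field; rewrite gt_eqF.
  by rewrite ler_piMr ?divr_ge0 ?(ltW gam0)// ler_pdivrMr// mul1r lerDl.
have [ka [w [ka0 hw wlip wtent]]] := chat del del0.
have [CF CF0 hCF] := rescaled_field_bounds L PhZ CPh0 Ph_lip r10.
pose C3 := CB * (ka * (1 + Cp * CF)) + CF.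
have pCF : 0 <= 1 + Cp * CF by rewrite addr_ge0// mulr_ge0.
have C30 : 0 <= C3 by rewrite addr_ge0// !mulr_ge0.
have [eps /andP[eps0 epsT] hs] := small_enough [:: 1; CF;
  2 * CF * (CB * ka * Cp + 1); (1 + Cp * CF) / rho; 180 * C * (C3 + 1) / gam]
    T0.
have eps1 : eps <= 1 by have := hs 1; rewrite mulr1; apply; rewrite !inE eqxx.
have epsCF : eps * CF <= 1 by apply: hs; rewrite !inE eqxx ?orbT.
have epssm : eps * CF * (CB * ka * Cp + 1) <= 1 / 2.
  have : eps * (2 * CF * (CB * ka * Cp + 1)) <= 1.
    by apply: hs; rewrite !inE eqxx ?orbT.
  by clear; lra.
have epsrho : eps * (1 + Cp * CF) <= rho.
  have : eps * ((1 + Cp * CF) / rho) <= 1 by apply: hs; rewrite !inE eqxx ?orbT.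
  by rewrite mulrA ler_pdivrMr// mul1r.
have epsC : C * ((C3 + 1) * eps) <= gam / 180.
  have : eps * (180 * C * (C3 + 1) / gam) <= 1.
    by apply: hs; rewrite !inE eqxx ?orbT.
  by rewrite mulrA ler_pdivrMr// mul1r; clear; lra.
have epsk0 : 0 < eps ^+ k by rewrite exprn_gt0.
(* After division by eps a target of size d has controlled coordinates of size
   at most eps, and a transversal coordinate below the guaranteed gain. *)
pose d := Num.min (eps ^+ 2 / (Cp + 1)) (eps * (eps ^+ k * (gam / 45)) / (Cl +
  1)).
have d0 : 0 < d.
  rewrite lt_min !divr_gt0 ?exprn_gt0 ?ltr_wpDl// !mulr_gt0//.
apply/nbhs_ballP; exists d => //= x; rewrite -ball_normE /= sub0r normrN => xd.
pose q := pi (eps^-1 *: x).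
have epsn : eps != 0 by rewrite gt_eqF.
have scaled c y : 0 <= c -> `|x| < eps * y / (c + 1) -> c * `|eps^-1 *: x| <= y.
  move=> c0; rewrite ltr_pdivlMr ?ltr_wpDl// normrZ gtr0_norm ?invr_gt0// => h.
  rewrite mulrCA ler_pdivrMl// (le_trans _ (ltW h))// mulrC.
  by rewrite ler_wpM2l// lerDl.
have qle : `|q| <= eps.
  rewrite (le_trans (hCp _))// scaled//.
  by rewrite (lt_le_trans xd)// ge_min expr2 lexx.
have vle : `|lam (eps^-1 *: x)| <= eps ^+ k * (gam / 45).
  rewrite (le_trans (hCl _))// scaled//.
  by rewrite (lt_le_trans xd)// ge_min lexx orbT.
pose Fe y := F (eps *: y).
pose eta := eps * CF.
have eta01 : 0 <= eta <= 1 by rewrite mulr_ge0// ltW.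
have [Fle Flip] := hCF eps eps0 eps1.
have q_le : `|q| + Cp * eta <= rho.
  rewrite (le_trans _ epsrho)// mulrDr mulr1 lerD// /eta mulrCA//.
(* The path of shapes: it is on at th = -1, 0 at th = 0 and op at th = 1. *)
pose om (th : R) := clamp th *: op + clamp (- th) *: on.
have omle th : `|om th| <= rho.
  rewrite (le_trans (ler_normD _ _))// !normrZ [leRHS](splitr rho).
  have c01 u : `|clamp u : R| <= 1.
    by have /andP[h1 h2] := clamp01 u; rewrite ger0_norm.
  by rewrite lerD//; rewrite -[leRHS]mul1r ler_pM.
have omlip th th' : `|om th - om th'| <= rho * `|th - th'|.
  rewrite /om opprD addrACA -!scalerBl (le_trans (ler_normD _ _))// !normrZ.
  rewrite [in leRHS](splitr rho) mulrDl lerD//.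
    by rewrite mulrC ler_pM// clamp_lipschitz.
  rewrite mulrC ler_pM// (le_trans (clamp_lipschitz _ _))//.
  by rewrite opprK addrC distrC.
have i1 : 0 <= (1 : R) <= 1 by rewrite lexx ler01.
have i0 : 0 <= (0 : R) <= 1 by rewrite lexx ler01.
pose sol th xi p z := guided B pi Fe q CB Cp M eta (fun p => w p (om th)) xi p
  z.
have /choice[S hS] : forall th, exists S : (R -> 'cV[R]_n) * 'cV[R]_m * (R ->
  'cV[R]_n),
    sol th S.1.1 S.1.2 S.2.
  move=> th.
  have [||xi [p [z hz]]] := @guided_exists R n m B pi Fe q CB Cp M rho ka eta
    CB0 hCB
    Cp0 hCp M0 ka0 eta01 Fle Flip epssm q_le (fun p => w p (om th)).
  - by move=> p pr; have [w0 w1 wM _] := hw p (om th) pr (omle th).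
  - move=> p p' pr pr' t.
    have := wlip p (om th) p' (om th) pr (omle _) pr' (omle _) t.
    by rewrite subrr normr0 addr0.
  - by exists (xi, p, z).
have prho th : `|(S th).1.2| <= rho.
  by have [_ ple _ _ _] := hS th; exact: le_trans ple q_le.
pose h th := lam ((S th).1.1 1).
have hlip th th' : `|h th - h th'| <= Cl * (2 * (CB * ka * rho)) * `|th - th'|.
  rewrite /h -linearB (le_trans (hCl _))// -mulrA ler_wpM2l//.
  have := @guided_dist R n m B pi Fe q CB Cp M ka eta CB0 hCB Cp0 hCp ka0
    eta01 Flip epssm _ _ _ _ _ _ _ _ `|om th - om th'| _ _ (hS th) (hS th').
  move=> /(_ _ _)/le_trans; apply => //.
    by move=> t _; apply: wlip.
  by rewrite -!mulrA !ler_wpM2l.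
have lamz th t : 0 <= t <= 1 -> lam ((S th).1.1 t) = lam ((S th).2 t).
  by have [_ _ xiE _ _] := hS th; move=> t01; rewrite xiE// linearD lamB add0r.
(* The solution is within e = CB * del + C3 * eps of its loop: chattering, the
   effect of a nonzero end point p on w, and the drift accumulated so far. *)
have est th t : 0 <= t <= 1 ->
    `|lam (Fe ((S th).1.1 t)) - eps ^+ k * ((t * (1 - t)) ^+ k * g (om th))|
    <= eps ^+ k * (gam / 90).
  have [xir ple xiE _ [z0 dz zle]] := hS th.
  have ple' : `|(S th).1.2| <= eps * (1 + Cp * CF).
    by rewrite (le_trans ple)// mulrDr mulr1 lerD// /eta mulrCA.
  pose e := CB * (ka * (eps * (1 + Cp * CF)) + del) + eta.
  have e0 : 0 <= e.
    have p0 : 0 <= eps * (1 + Cp * CF) by exact: le_trans ple'.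
    rewrite addr_ge0//; last by case/andP: eta01.
    by rewrite mulr_ge0// addr_ge0 ?(ltW del0)// mulr_ge0.
  move=> t01; apply: le_trans (hC eps (om th) e (fun t => w (S th).1.2 (om th)
    t)
    _ _ eps0 eps1 _ e0 _ xiE z0 dz _ t t01) _.
  - by rewrite (le_trans (hCB _))// /r2 (@le_trans _ _ (CB * rho)) ?lerDr//
      ler_wpM2l.
  - by move=> u _; rewrite (le_trans (xir u))// /r2 lerDl mulr_ge0// ltW.
  - move=> u u01; rewrite xiE//.
    rewrite [X in `|X|](_ : _ = B (w (S th).1.2 (om th) u - (u * (1 - u)) *: om
      th)
      + (S th).2 u); last first.
      rewrite [in RHS]linearB [in RHS]linearZ/=.
      exact: addrAC.
    rewrite (le_trans (ler_normD _ _))// /e lerD ?zle//.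
    rewrite (le_trans (hCB _))// ler_wpM2l//.
    have p0 : `|0 : 'cV[R]_m| <= rho by rewrite normr0 ltW.
    rewrite -[X in `|X|](subrKA (w 0 (om th) u)) (le_trans (ler_normD _ _))//.
    rewrite lerD//; last by apply: wtent.
    rewrite (le_trans (wlip _ _ _ _ _ _ _ _ _))//.
    by rewrite subrr normr0 addr0 subr0 ler_wpM2l.
  - rewrite mulrAC mulrC ler_wpM2l ?(ltW epsk0)//.
    have -> : C * (e + eps) = C * (CB * del) + C * ((C3 + 1) * eps).
      by rewrite /e /C3 /eta; ring.
    by move: hdel epsC; clear; lra.
have h1 : eps ^+ k * (gam / 45) <= h 1.
  have [xir ple xiE _ [z0 dz zle]] := hS 1.
  rewrite /h lamz//.
  have omE : om 1 = op.
    rewrite /om clamp_id// scale1r /clamp min_l ?max_l ?scale0r ?addr0//;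
      clear; lra.
  have := @drift_gain R (lam \o (S 1).2) (fun t => lam (Fe ((S 1).1.1 t)))
    (eps ^+ k * g op) (eps ^+ k * (gam / 90)) k _ k12 _ _.
  rewrite /= z0 linear0 subr0 => H.
  apply: le_trans (H _ _ _).
  - have := ler_wpM2l (ltW epsk0) gamp; clear; lra.
  - by rewrite mulr_ge0// ltW.
  - by move=> t t01; apply: is_derive_linear; exact: dz.
  - by move=> t t01; have := est 1 t t01; rewrite omE ler_norml => /andP[];
      clear; lra.
have hN1 : h (-1) <= - (eps ^+ k * (gam / 45)).
  have [xir ple xiE _ [z0 dz zle]] := hS (-1).
  rewrite /h lamz// lerNr.
  have omE : om (-1) = on.
    rewrite /om opprK [clamp 1]clamp_id// scale1r /clamp min_l ?max_l ?scale0r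
      ?add0r//; clear; lra.
  have := @drift_gain R (- (lam \o (S (-1)).2)) (fun t => - lam (Fe ((S
    (-1)).1.1 t)))
    (eps ^+ k * (- g on)) (eps ^+ k * (gam / 90)) k _ k12 _ _.
  rewrite /= -![(- _ : _ -> _) _]/(- _) /= z0 linear0 oppr0 subr0 => H.
  apply: le_trans (H _ _ _).
  - have := ler_wpM2l (ltW epsk0) gamn; clear; lra.
  - by rewrite mulr_ge0 ?(ltW epsk0)// oppr_ge0 ltW.
  - by move=> t t01; apply: is_deriveN; apply: is_derive_linear; exact: dz.
  - by move=> t t01; have := est (-1) t t01; rewrite omE ler_norml => /andP[];
      clear; lra.
have [th _ hth] : exists2 th, th \in `[(-1), 1] & h th = lam (eps^-1 *: x).
  apply: IVT; first by clear; lra.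
    by apply: continuous_subspaceT; apply: lipschitz_continuous hlip.
  move: vle; rewrite ler_norml => /andP[v1 v2].
  by rewrite ge_min le_max; apply/andP; split; apply/orP; [left; move: hN1
    v1|right; move: h1 v2]; clear; lra.
have [xir ple xiE piz [z0 dz zle]] := hS th.
have [w0 w1 wM wre] := hw _ (om th) (prho th) (omle th).
have xi1 : (S th).1.1 1 = eps^-1 *: x.
  apply/eqP; rewrite -subr_eq0; apply/eqP; apply: lam_pi_inj.
    by rewrite linearB -/(h th) hth subrr.
  by rewrite linearB/= xiE// linearD piB w1 [X in X - _]addrC piz subrr.
exists eps; first by rewrite /= in_itv/= epsT ltW.
rewrite -[x](scalerKV epsn) -xi1.
apply: (@reach_rescaled R n m F f U B eps r1 (w (S th).1.2 (om th)) (S th).1.1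
  (S th).2) => //.
  move=> a b a01 b01; rewrite !xiE// opprD addrACA -linearB (le_trans
    (ler_normD _ _))//.
  rewrite /r1 mulrDl lerD//.
    by rewrite (le_trans (hCB _))// -mulrA ler_wpM2l.
  apply: le_trans (MVT_le _ dz _ b01 a01) _; first exact: (proj1 (andP eta01)).
    by move=> u u01; exact: Fle.
  by rewrite ler_wpM2r//; case/andP: eta01.
by rewrite xiE// w0 z0 linear0 addr0.
Qed.

(** * Quadratic drift and the controllability criterion *)

(** A semidefinite form vanishing on a basis is zero: if [g <= 0] then each
basis vector is isotropic, hence lies in the radical, since otherwise [t |-> g
(v + t e_i)] would be affine and not constant, thus unbounded. *)
Lemma quadratic_positive (R : realType) m (g : 'cV[R]_m -> R) :
  (forall v w, exists b, forall t, g (v + t *: w) = g v + t * b + t ^+ 2 * g w)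
    ->
  (forall i, g (delta_mx i 0) = 0) -> (exists v, g v <> 0) ->
  exists v, 0 < g v.
Proof.
move=> gq gd [v gv]; apply: contrapT => npos; apply: gv.
have gle u : g u <= 0 by rewrite leNgt; apply/negP => gu; apply: npos; exists u.
have g0 : g 0 = 0.
  have [b hb] := gq 0 0; have h1 := hb 1; have h2 := hb 2.
  by rewrite !scaler0 addr0 in h1 h2; lra.
have gt u i t : g (u + t *: delta_mx i 0) = g u.
  have [b hb] := gq u (delta_mx i 0).
  rewrite hb gd mulr0 addr0; have [->|b0] := eqVneq b 0; first by rewrite mulr0
    addr0.
  have := gle (u + ((1 - g u) / b) *: delta_mx i 0).
  by rewrite hb gd mulr0 addr0 divfK// addrC subrK ler10.
rewrite (matrix_sum_delta v).
under eq_bigr do rewrite big_ord1.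
elim: (index_enum _) => [|i s ih]; first by rewrite big_nil.
by rewrite big_cons addrC gt.
Qed.

Section PhiFacts.
Context {R : realType} {n : nat}.
Variables a b c : 'cV[R]_n.

Lemma Phi_entry x i : Phi a b c x i 0 =
  a i 0 * ((P2 R n *m x) i 0) ^+ 2 + b i 0 * ((P3 R n *m x) i 0) ^+ 2
  + c i 0 * ((P2 R n *m x) i 0 * (P3 R n *m x) i 0).
Proof.
rewrite /Phi /hadamard; move: (P2 R n *m x) (P3 R n *m x) => p q.
by rewrite !mxE; ring.
Qed.

Lemma Phi_polar x y (t : R) : Phi a b c (x + t *: y) =
  Phi a b c x + t *: (Phi a b c (x + y) - Phi a b c x - Phi a b c y)
  + t ^+ 2 *: Phi a b c y.
Proof.
apply/matrixP => i j; rewrite (ord1 j).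
have lin (M : 'M[R]_n) (s : R) : (M *m (x + s *: y)) i 0 = (M *m x) i 0 + s *
  (M *m y) i 0.
  rewrite mulmxDr -scalemxAr; move: (M *m x) (M *m y) => p q; by rewrite !mxE.
have lin1 (M : 'M[R]_n) : (M *m (x + y)) i 0 = (M *m x) i 0 + (M *m y) i 0.
  rewrite mulmxDr; move: (M *m x) (M *m y) => p q; by rewrite !mxE.
have entry := Phi_entry; move: (Phi a b c) entry => G entry.
rewrite !mxE !entry !lin !lin1.
move: ((P2 R n *m x) i 0) ((P3 R n *m x) i 0) ((P2 R n *m y) i 0) ((P3 R n *m
  y) i 0).
by move=> p q p' q'; ring.
Qed.

Lemma Phi_scale (t : R) x : Phi a b c (t *: x) = t ^+ 2 *: Phi a b c x.
Proof.
apply/matrixP => i j; rewrite (ord1 j).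
have entry := Phi_entry; move: (Phi a b c) entry => G entry.
rewrite mxE !entry -!scalemxAr; move: (P2 R n *m x) (P3 R n *m x) => p q.
by rewrite !mxE; ring.
Qed.

Lemma Phi_lipschitz : exists2 C, 0 <= C & forall x z,
  `|Phi a b c x - Phi a b c z| <= C * (`|x| + `|z|) * `|x - z|.
Proof.
have [C2 C20 h2] := linear_bound (mulmx (P2 R n) : {linear 'cV[R]_n ->
  'cV[R]_n}).
have [C3 C30 h3] := linear_bound (mulmx (P3 R n) : {linear 'cV[R]_n ->
  'cV[R]_n}).
exists (`|a| * (C2 * C2) + `|b| * (C3 * C3) + `|c| * (C2 * C3)).
  by rewrite !addr_ge0// !mulr_ge0.
move=> x z; apply/cV_norm_leP => [|i].
  apply: mulr_ge0 => //; apply: mulr_ge0; last exact: addr_ge0.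
  by rewrite !addr_ge0// !mulr_ge0.
have entry := Phi_entry; move: (Phi a b c) entry => G entry.
rewrite 2!mxE !entry.
have ent (v : 'cV[R]_n) : `|v i 0| <= `|v| by apply: (cV_norm_leP _ _).1.
have e2 (v : 'cV[R]_n) : `|(P2 R n *m v) i 0| <= C2 * `|v| by apply: (le_trans
  (ent _)); exact: h2.
have e3 (v : 'cV[R]_n) : `|(P3 R n *m v) i 0| <= C3 * `|v| by apply: (le_trans
  (ent _)); exact: h3.
have d2 : (P2 R n *m (x - z)) i 0 = (P2 R n *m x) i 0 - (P2 R n *m z) i 0.
  by rewrite mulmxBr; move: (_ *m x) (_ *m z) => u v; rewrite !mxE.
have d3 : (P3 R n *m (x - z)) i 0 = (P3 R n *m x) i 0 - (P3 R n *m z) i 0.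
  by rewrite mulmxBr; move: (_ *m x) (_ *m z) => u v; rewrite !mxE.
have := e2 (x - z); have := e3 (x - z); rewrite d2 d3.
move: {d2 d3} (e2 x) (e2 z) (e3 x) (e3 z).
move: ((P2 R n *m x) i 0) ((P3 R n *m x) i 0) ((P2 R n *m z) i 0) ((P3 R n *m
  z) i 0).
move=> p q p' q' hp hp' hq hq' hqq hpp.
rewrite [X in `|X|](_ : _ = a i 0 * ((p + p') * (p - p')) + b i 0 * ((q + q') *
  (q - q'))
   + c i 0 * (p * (q - q') + q' * (p - p'))); last by ring.
have prod3 (al u v A u' v' : R) : `|al| <= A -> `|u| <= u' -> `|v| <= v' ->
    `|al * (u * v)| <= A * (u' * v').
  by move=> h1 h2' h3'; rewrite !normrM ler_pM// ?mulr_ge0// ler_pM.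
have s2 : `|p + p'| <= C2 * `|x| + C2 * `|z| by rewrite (le_trans (ler_normD _
  _))// lerD.
have s3 : `|q + q'| <= C3 * `|x| + C3 * `|z| by rewrite (le_trans (ler_normD _
  _))// lerD.
have s23 : `|p * (q - q') + q' * (p - p')| <=
    C2 * `|x| * (C3 * `|x - z|) + C3 * `|z| * (C2 * `|x - z|).
  by rewrite (le_trans (ler_normD _ _))// !normrM lerD// ler_pM.
have h1 := prod3 _ _ _ _ _ _ (ent a) s2 hpp.
have h2' := prod3 _ _ _ _ _ _ (ent b) s3 hqq.
have h3' : `|c i 0 * (p * (q - q') + q' * (p - p'))| <= `|c| *
    (C2 * `|x| * (C3 * `|x - z|) + C3 * `|z| * (C2 * `|x - z|)).
  by rewrite normrM ler_pM.
rewrite (le_trans (ler_normD _ _))// (le_trans (lerD (ler_normD _ _) (lexx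
  _)))//.
rewrite (le_trans (lerD (lerD h1 h2') h3'))// le_eqVlt; apply/orP; left.
by apply/eqP; ring.
Qed.

End PhiFacts.

(** Coordinates in a basis that completes [f] by a vector [e]: [lam] is the
coordinate along [e], the entries of [pi] are those along [f], and [B] maps a
control to the velocity that it produces. *)
Lemma hyperplane_frame (R : realType) n (f : n.-1.-tuple 'cV[R]_n) :
  (0 < n)%N -> free f ->
  exists (e : 'cV[R]_n) (lam : {linear 'cV[R]_n -> R^o})
    (pi : {linear 'cV[R]_n -> 'cV[R]_(n.-1)}) (B : {linear 'cV[R]_(n.-1) ->
      'cV[R]_n}),
  [/\ lam e = 1, forall v, v \in <<f>>%VS <-> lam v = 0,
    forall u, B u = \sum_(i < n.-1) u i 0 *: tnth f i,
    forall u, pi (B u) = u &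
    forall v, lam v = 0 -> pi v = 0 -> v = 0].
Proof.
move=> n0 ff.
have dimf : \dim <<f>> = n.-1 by move: ff; rewrite /free size_tuple => /eqP.
have dimV : \dim (fullv : {vspace 'cV[R]_n}) = n by rewrite dimvf /dim/= muln1.
have [e ef] : exists e, e \notin <<f>>%VS.
  apply: contrapT => ne.
  have /dimvS : (fullv <= <<f>>)%VS.
    by apply/subvP => v _; apply: contrapT => /negP nv; apply: ne; exists v.
  by rewrite dimV dimf -ltnS prednK// ltnn.
pose X : n.-1.+1.-tuple 'cV[R]_n := [tuple of e :: f].
have fX : free X by rewrite free_cons ef.
have spX : (<<X>> = fullv)%VS.
  apply/eqP; rewrite eqEdim subvf/= dimV.
  by move: fX; rewrite /free => /eqP ->; rewrite size_tuple prednK.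
have XE v : v = coord X ord0 v *: e +
    \sum_(j < n.-1) coord X (lift ord0 j) v *: tnth f j.
  have vX : v \in <<X>>%VS by rewrite spX memvf.
  rewrite {1}(coord_span vX) big_ord_recl/=; congr (_ + _).
  by apply: eq_bigr => j _; rewrite (tnth_nth 0).
pose lamf (v : 'cV[R]_n) : R^o := coord X ord0 v.
have lam_lin : linear lamf by move=> k u v; rewrite /lamf linearP.
pose lam : {linear 'cV[R]_n -> R^o} := HB.pack lamf (GRing.isLinear.Build _ _ _
  _ lamf lam_lin).
pose pif (v : 'cV[R]_n) : 'cV[R]_(n.-1) := \col_j coord X (lift ord0 j) v.
have pi_lin : linear pif.
  by move=> k u v; apply/matrixP => i j; rewrite !mxE linearP.
pose pi : {linear 'cV[R]_n -> 'cV[R]_(n.-1)} :=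
  HB.pack pif (GRing.isLinear.Build _ _ _ _ pif pi_lin).
pose A : 'M[R]_(n, n.-1) := \matrix_(i, j) tnth f j i 0.
have BE (u : 'cV[R]_(n.-1)) : A *m u = \sum_(i < n.-1) u i 0 *: tnth f i.
  apply/matrixP => i j; rewrite !mxE summxE (ord1 j).
  by apply: eq_bigr => l _; rewrite !mxE mulrC.
have coordf (j : 'I_n.-1) (i : 'I_n.-1.+1) : coord X i (tnth f j) = (lift ord0
  j == i)%:R.
  have -> : tnth f j = X`_(lift ord0 j) by rewrite (tnth_nth 0).
  by rewrite coord_free.
exists e, lam, pi, (mulmx A); split => //.
- by rewrite /lam/= /lamf (_ : e = X`_(ord0 : 'I_n.-1.+1))// coord_free.
- move=> v; split.
    move=> /coord_span ->; rewrite linear_sum big1// => i _.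
    by rewrite linearZ /lam/= /lamf -tnth_nth coordf [_ *: _]mulr0.
  rewrite /lam/= /lamf => v0; rewrite (XE v) v0 scale0r add0r.
  by apply: memv_suml => j _; apply: memvZ; apply: memv_span; exact: mem_tnth.
- move=> u; rewrite [X in pi X](BE u) /pi/= /pif.
  apply/matrixP => i j; rewrite mxE (ord1 j) linear_sum/=.
  rewrite (bigD1 i)//= big1 => [|l li].
    by rewrite linearZ/= coordf eqxx mulr1 addr0.
  by rewrite linearZ/= coordf (inj_eq lift_inj) (negbTE li) mulr0.
- move=> v; rewrite /lam/= /lamf => v0 piv0; rewrite (XE v) v0 scale0r add0r.
  rewrite big1// => j _; have := congr1 (fun M : 'cV[R]_(n.-1) => M j 0) piv0.
  by rewrite !mxE => ->; rewrite scale0r.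
Qed.

(** Both [L] and [Ph] preserve the hyperplane [lam = 0], so the velocity of [lam
x] is [O(lam x)] along any bounded trajectory. *)
Lemma invariant_hyperplane_not_controllable (R : realType) n m
    (L : {linear 'cV[R]_n -> 'cV[R]_n}) (Ph : 'cV[R]_n -> 'cV[R]_n) (CPh : R)
    (lam : {linear 'cV[R]_n -> R^o}) (e : 'cV[R]_n)
    (f : m.-tuple 'cV[R]_n) (U : set 'cV[R]_m) :
  0 <= CPh ->
  (forall x z, `|Ph x - Ph z| <= CPh * (`|x| + `|z|) * `|x - z|) ->
  lam e = 1 -> (forall i, lam (tnth f i) = 0) ->
  (forall v, lam v = 0 -> lam (L v) = 0) ->
  (forall v, lam v = 0 -> lam (Ph v) = 0) ->
  ~ small_time_locally_controllable (fun x => L x + Ph x) f U 0.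
Proof.
move=> CPh0 Ph_lip lame lamf lamL lamPh /(_ 1 ltr01) /nbhs_ballP[r /= r0 hr].
have e0 : 0 < `|e| + 1 by rewrite ltr_wpDl.
(* A target off the hyperplane but within distance r of the origin. *)
pose k := r / 2 / (`|e| + 1).
have k0 : 0 < k by rewrite !divr_gt0.
have [|T T01 [x [[u uad [xac dx]] x0 xT]]] := hr (k *: e).
  rewrite -ball_normE /= sub0r normrN normrZ (gtr0_norm k0).
  rewrite (@le_lt_trans _ _ (k * (`|e| + 1)))//.
    by rewrite ler_wpM2l ?(ltW k0)// lerDl.
  by rewrite /k divfK ?gt_eqF// ltr_pdivrMr// mulr_natr mulr2n ltrDl.
have T0 : 0 <= T by move: T01; rewrite /= in_itv/= => /andP[].
have [Bd hBd] := absolutely_continuous_bounded T0 xac.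
have [Cl Cl0 hCl] := linear_bound lam.
have Bd0 : 0 <= Bd.
  by apply: le_trans (normr_ge0 (x 0)) (hBd 0 _); rewrite lexx.
pose K := `|lam (L e)| + Cl * (CPh * (Bd + (Bd + Cl * Bd * `|e|)) * `|e|).
have K0 : 0 <= K by rewrite addr_ge0// !mulr_ge0// !addr_ge0// !mulr_ge0.
(* The difference of v and its projection s along e onto the kernel of lam is
   lam v *: e, so the part of the drift that leaves the kernel is O(lam v). *)
have bound v : `|v| <= Bd -> `|lam (L v + Ph v)| <= K * `|lam v|.
  move=> vB; pose s := v - lam v *: e.
  have lams : lam s = 0 by rewrite /s linearB linearZ/= lame [_ *: _]mulr1
    subrr.
  have vE : v = s + lam v *: e by rewrite /s subrK.
  rewrite linearD.
  have -> : lam (L v) = lam v * lam (L e).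
    by rewrite {1}vE linearD linearZ linearD linearZ (lamL s lams) add0r.
  have -> : lam (Ph v) = lam (Ph v - Ph s) by rewrite linearB/= (lamPh s)//
    subr0.
  have lv : `|lam v| <= Cl * Bd by rewrite (le_trans (hCl _))// ler_wpM2l.
  have sB : `|s| <= Bd + Cl * Bd * `|e|.
    by rewrite (le_trans (ler_normB _ _))// normrZ lerD// ler_wpM2r.
  rewrite (le_trans (ler_normD _ _))// /K mulrDl lerD//; first by rewrite
    normrM mulrC.
  rewrite (le_trans (hCl _))// -[leRHS]mulrA ler_wpM2l// (le_trans (Ph_lip _
    _))//.
  have -> : v - s = lam v *: e by rewrite /s opprB addrC subrK.
  rewrite normrZ -[leRHS]mulrA [`|e| * _]mulrC ler_wpM2r ?mulr_ge0//.
  by rewrite ler_wpM2l// lerD.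
have : (lam \o x) T = 0.
  apply: (@gronwall_ae R (lam \o x) K T) => //.
  - move=> d d0; have C1 : 0 < Cl + 1 by rewrite ltr_wpDl.
    have [d' d'0 hd'] := xac (d / (Cl + 1)) (divr_gt0 d0 C1).
    exists d' => // l s t st dis sm.
    have := hd' l s t st dis sm; rewrite ltr_pdivlMr//; apply: le_lt_trans.
    rewrite mulr_suml ler_sum// => i _ /=; rewrite -linearB (le_trans (hCl
      _))//.
    by rewrite mulrC ler_wpM2l// lerDl.
  - by rewrite /= x0 linear0.
  - move: dx; apply: filterS; first exact: (ae_filter_ringOfSetsType
      lebesgue_measure).
    move=> t ht tT; have dt := ht tT.
    exists (lam (L (x t) + Ph (x t))).
      have := is_derive_linear lam dt.
      rewrite linearD [X in _ + X](_ : _ = 0) ?addr0// linear_sum big1// => i _.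
      by rewrite linearZ /= lamf [_ *: _]mulr0.
    apply: bound; apply: hBd; move: tT; rewrite /= in_itv/=; exact.
by rewrite /= xT linearZ/= lame => /eqP; rewrite [_ *: _]mulr1 gt_eqF.
Qed.

Theorem theorem3p7 (R : realType) (n : nat) (hn : (2 <= n)%N)
    (L : 'End('cV[R]_n)) (a b c : 'cV[R]_n)
    (f : n.-1.-tuple 'cV[R]_n) (hf : free f)
    (U : set 'cV[R]_(n.-1))
    (hUbounded : bounded_set U)
    (hUaffine : affine_hull U = setT)
    (hUproper : interior (convex_hull U) 0)
    (hS0 : ~~ (L @: S0 f <= S0 f)%VS \/
           (forall i, Phi a b c (tnth f i) \in S0 f)) :
  small_time_locally_controllable (fun x => L x + Phi a b c x) f U 0 <->
  S1 L a b c f = setT.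
Proof.
have [e [lam [pi [B [lame lamP BE piB inj]]]]] := hyperplane_frame (ltnW hn) hf.
have [CPh CPh0 Ph_lip] := Phi_lipschitz a b c.
have lamf i : lam (tnth f i) = 0 by apply/lamP; apply: memv_span; exact:
  mem_tnth.
have lamB u : lam (B u) = 0.
  by rewrite BE linear_sum big1// => i _; rewrite linearZ/= lamf [_ *: _]mulr0.
have Bpi v : lam v = 0 -> B (pi v) = v.
  move=> v0; apply/eqP; rewrite -subr_eq0; apply/eqP; apply: inj.
    by rewrite linearB lamB v0 subrr.
  by rewrite linearB piB subrr.
pose gens := [set L om | om in [set v | v \in S0 f]] `|`
             [set Phi a b c om | om in [set v | v \in S0 f]].
have S1P : S1 L a b c f = setT <-> exists2 w, gens w & lam w <> 0.
  split=> [S1T|[w gw lw]].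
    apply: contrapT => ng.
    have : S1 L a b c f e by rewrite S1T.
    move=> [v /= vS [w [k [w' [d [gw' ->]]]] E]].
    have : lam e = 0.
      rewrite -E linearD ((lamP v).1 vS) add0r linear_sum big1// => i _.
      rewrite linearZ/= (_ : lam (w' i) = 0) ?[_ *: _]mulr0//.
      by apply: contrapT => lw; apply: ng; exists (w' i) => //; exact: gw'.
    by rewrite lame => /eqP; rewrite oner_eq0.
  apply/seteqP; split=> // x _.
  exists (x - (lam x / lam w) *: w).
    apply/lamP; rewrite linearB linearZ/= [_ *: _]divfK ?subrr//; exact/eqP.
  exists ((lam x / lam w) *: w); last by rewrite subrK.
  exists 1%N, (fun=> w), (fun=> lam x / lam w); split => //.
  by rewrite big_ord1.
rewrite S1P; split=> [stlc|[w gw lw]].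
  apply: contrapT => ng.
  apply: (@invariant_hyperplane_not_controllable R n n.-1 L (Phi a b c) CPh lam
    e f U) stlc => //.
    move=> v lv; apply: contrapT => nv; apply: ng; exists (L v) => //.
    by left; exists v => //; apply/lamP.
  move=> v lv; apply: contrapT => nv; apply: ng; exists (Phi a b c v) => //.
  by right; exists v => //; apply/lamP.
have m0 : (0 < n.-1)%N by rewrite -ltnS prednK// ltnW.
have steer := @local_steering R n n.-1 L (Phi a b c) CPh B pi lam f U _ _ _ _
  (@Phi_scale R n a b c) CPh0 Ph_lip piB lamB inj BE m0 hUbounded hUproper.
have [[om [omS Lom]]|nL] := pselect (exists om, om \in S0 f /\ lam (L om) <> 0).
  have om0 : lam om = 0 by apply/lamP.
  have sq0 : 0 < lam (L om) * lam (L om) by rewrite -expr2 exprn_even_gt0//=;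
    apply/eqP.
  apply: (steer 1%N (fun v => lam (L (B v))) (lam (L om) *: pi om) (- (lam (L
    om) *: pi om))).
  - by [].
  - exact: (drift_order_linear L B lam (@Phi_scale R n a b c) CPh0 Ph_lip).
  - by move=> k v _; rewrite !linearZ.
  - by rewrite !linearZ/= Bpi.
  - rewrite !linearN !linearZ/= Bpi//.
    by rewrite [_ *: _]mulrN oppr_lt0.
have lamL v : lam v = 0 -> lam (L v) = 0.
  by move=> lv; apply: contrapT => lLv; apply: nL; exists v; split => //;
    apply/lamP.
have [|Phf] := hS0.
  move=> /negP; case; apply/subvP => v /memv_imgP[v' v'S ->].
  by apply/lamP; apply: lamL; exact/lamP.
have [om omS lw'] : exists2 om, om \in S0 f & lam (Phi a b c om) <> 0.
  case: gw lw => [[om omS <-] lw|[om omS <-] lw]; last by exists om.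
  by case: lw; apply: lamL; exact/lamP.
have om0 : lam om = 0 by apply/lamP.
pose g v := lam (Phi a b c (B v)).
have lamLE v : lam (L v) = lam (L e) * lam v.
  have : lam (L (v - lam v *: e)) = 0.
    by apply: lamL; rewrite linearB linearZ/= lame [_ *: _]mulr1 subrr.
  rewrite !linearB !linearZ/= [_ *: _]mulrN => /eqP; rewrite subr_eq0 => /eqP
    ->.
  by rewrite mulrC.
have gq v v' : exists d, forall t, g (v + t *: v') = g v + t * d + t ^+ 2 * g
  v'.
  rewrite /g; exists (lam (Phi a b c (B v + B v') - Phi a b c (B v) - Phi a b c
    (B v'))) => t.
  have -> : B (v + t *: v') = B v + t *: B v' by rewrite linearD linearZ.
  rewrite Phi_polar.
  move: (Phi a b c (B v + B v') - Phi a b c (B v) - Phi a b c (B v')) => x.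
  by rewrite linearD linearD linearZ linearZ.
have gd i : g (delta_mx i 0) = 0.
  rewrite /g (_ : B _ = tnth f i); first by apply/lamP; exact: Phf.
  rewrite BE (bigD1 i)//= big1 => [|j ji]; first by rewrite mxE !eqxx scale1r
    addr0.
  by rewrite mxE (negbTE ji) scale0r.
have gn : exists v, g v <> 0 by exists (pi om); rewrite /g Bpi.
have [vp gvp] := quadratic_positive gq gd gn.
have [vn gvn] : exists v, 0 < - g v.
  apply: (@quadratic_positive R n.-1 (fun v => - g v)).
  - move=> v v'; have [d hd] := gq v v'; exists (- d) => t; rewrite hd; ring.
  - by move=> i; rewrite gd oppr0.
  - by case: gn => v gv; exists v => /eqP; rewrite oppr_eq0 => /eqP.
apply: (steer 2%N g vp vn) => //.
- exact: (drift_order_quadratic (@Phi_scale R n a b c) CPh0 Ph_lip lamB lamLE).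
- by move=> k v _; rewrite /g linearZ Phi_scale linearZ.
- by rewrite -oppr_gt0.
Qed.
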